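(* Let $f:\mathbb{R}^d\to\mathbb{R}$, let ${\bm{x}}^\star$ be a local minimizer of $f$ with $f$ twice differentiable in a neighborhood of ${\bm{x}}^\star$, and let ${\bm{H}}:=\nabla^2 f({\bm{x}}^\star)$ satisfy ${\bm{H}}\succeq 0$, ${\bm{H}}\neq{\bm{0}}$, with eigenvalues $\lambda_1\ge\cdots\ge\lambda_d\ge0$, $\lambda_{\max}({\bm{H}}):=\lambda_1$. Consider ZO-GDM with step size $\eta>0$, momentum $\beta\in[0,1)$ and smoothing parameter $\mu>0$ applied to $f_{\mathrm{quad}}({\bm{x}})=f({\bm{x}}^\star)+\tfrac12({\bm{x}}-{\bm{x}}^\star)^\top{\bm{H}}({\bm{x}}-{\bm{x}}^\star)$: \[ {\bm{m}}_{t+1}=\beta{\bm{m}}_t+\widehat\nabla f_{\mathrm{quad}}({\bm{x}}_t),\qquad {\bm{x}}_{t+1}={\bm{x}}_t-\eta{\bm{m}}_{t+1},\qquad {\bm{m}}_0={\bm{0}}, \] where $\widehat\nabla f_{\mathrm{quad}}({\bm{x}}_t)=\frac{f_{\mathrm{quad}}({\bm{x}}_t+\mu{\bm{u}}_t)-f_{\mathrm{quad}}({\bm{x}}_t-\mu{\bm{u}}_t)}{2\mu}{\bm{u}}_t$ with ${\bm{u}}_t\overset{\mathrm{i.i.d.}}{\sim}\mathcal N({\bm{0}},{\bm{I}}_d)$. Then $\eta^\star_{\mathrm{mean}}=2(1+\beta)/\lambda_{\max}({\bm{H}})$, and the mean-square critical step size $\eta^\star_{\mathrm{ms}}$ is the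 unique $\eta>0$ satisfying \[ \eta\lambda_{\max}({\bm{H}})<1-\beta^2\quad\text{and}\quad\sum_{i=1}^d\frac{\eta\lambda_i}{2(1-\beta)\bigl(1-\frac{\eta\lambda_i}{1-\beta^2}\bigr)}=1, \] and it satisfies \[ \frac{2(1-\beta)}{\Tr({\bm{H}})+\frac{2\lambda_{\max}({\bm{H}})}{1+\beta}}\le\eta^\star_{\mathrm{ms}}\le\frac{2(1-\beta)}{\Tr({\bm{H}})}. \]
   Context: For an optimizer with step size $\eta$ applied to $f_{\mathrm{quad}}$ producing iterates $\{{\bm{x}}_t\}_{t\ge0}$ (with the auxiliary momentum initialized at ${\bm{0}}$), the critical step size in the mean is $\eta^\star_{\mathrm{mean}}:=\sup\{\eta>0:\ \forall {\bm{x}}_0\in\mathbb{R}^d,\ \sup_{t\ge0}\|\mathbb{E}[{\bm{x}}_t-{\bm{x}}^\star]\|<\infty\}$ and the mean-square critical step size is $\eta^\star_{\mathrm{ms}}:=\sup\{\eta>0:\ \forall {\bm{x}}_0\in\mathbb{R}^d,\ \sup_{t\ge0}\mathbb{E}\|{\bm{x}}_t-{\bm{x}}^\star\|^2<\infty\}$. *)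

(* Defs.v *)
From HB Require Import structures.
From mathcomp Require Import all_boot all_order all_algebra.
From mathcomp Require Import all_classical all_reals all_analysis.
Set Implicit Arguments. Unset Strict Implicit. Unset Printing Implicit Defensive.
Import Order.TTheory GRing.Theory Num.Theory.
Import numFieldNormedType.Exports.
Local Open Scope classical_set_scope.
Local Open Scope ring_scope.

Section Defs.
Variable R : realType.
Variable d : nat.

Definition evec (i : 'I_d) : 'cV[R]_d := delta_mx i 0.

Definition hessian (f : 'cV[R]_d -> R) (x : 'cV[R]_d) : 'M[R]_d :=
  \matrix_(i, j) 'D_(evec j) ('D_(evec i) f) x.

Definition local_minimizer (f : 'cV[R]_d -> R) (x : 'cV[R]_d) : Prop :=
  \forall y \near x, f x <= f y.

(* f is twice differentiable in a neighborhood of x: near x, f is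
   differentiable and its derivative is differentiable (i.e. every first
   partial derivative is differentiable). *)
Definition twice_differentiable_near (f : 'cV[R]_d -> R) (x : 'cV[R]_d) : Prop :=
  \forall y \near x, differentiable f y /\
     (forall i : 'I_d, differentiable ('D_(evec i) f) y).

Definition psd (H : 'M[R]_d) : Prop :=
  H^T = H /\ forall v : 'cV[R]_d, 0 <= (v^T *m H *m v) 0 0.

Definition eigenvalues_of (H : 'M[R]_d) (lam : 'I_d -> R) : Prop :=
  char_poly H = \prod_(i < d) ('X - (lam i)%:P).

Definition lambda_max (lam : 'I_d -> R) : R := \big[Num.max/(0:R)]_(i < d) lam i.

Definition fquad (fstar : R) (xstar : 'cV[R]_d) (H : 'M[R]_d) (x : 'cV[R]_d) : R :=
  fstar + 2^-1 * (((x - xstar)^T *m H *m (x - xstar)) 0 0).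

Definition zo_grad (F : 'cV[R]_d -> R) (mu : R) (x u : 'cV[R]_d) : 'cV[R]_d :=
  ((F (x + mu *: u) - F (x - mu *: u)) / (2 * mu)) *: u.

Fixpoint zo_gdm {T : Type} (F : 'cV[R]_d -> R) (mu beta eta : R)
    (x0 : 'cV[R]_d) (u : nat -> T -> 'cV[R]_d) (t : nat) (w : T)
    : 'cV[R]_d * 'cV[R]_d :=
  match t with
  | 0 => (0, x0)
  | t'.+1 =>
      let: (m, x) := zo_gdm F mu beta eta x0 u t' w in
      let m' := beta *: m + zo_grad F mu x (u t' w) in
      (m', x - eta *: m')
  end.

Definition sqnorm (v : 'cV[R]_d) : R := \sum_(i < d) (v i 0) ^+ 2.

End Defs.

Section Prob.
Local Open Scope ereal_scope.

Definition mutually_independent {dT : measure_display} {T : measurableType dT}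
    {R : realType} (P : probability T R) {I : eqType} (X : I -> T -> R) : Prop :=
  forall (s : seq I) (B : I -> set R), uniq s ->
    (forall j, measurable (B j)) ->
    P (\big[setI/setT]_(j <- s) (X j @^-1` B j)) =
    \prod_(j <- s) P (X j @^-1` B j).

Definition iid_std_gaussian {dT : measure_display} {T : measurableType dT}
    {R : realType} (P : probability T R) (d : nat) (u : nat -> T -> 'cV[R]_d) : Prop :=
  let X := fun (ti : nat * 'I_d) (w : T) => u ti.1 w ti.2 ord0 in
  (forall ti, measurable_fun setT (X ti)) /\
  (forall ti (B : set R), measurable B ->
     P (X ti @^-1` B) = normal_prob 0%R 1%R B) /\
  mutually_independent P X.

Definition iterate {T : Type} {R : realType} {d : nat} (F : 'cV[R]_d -> R)
  (mu beta eta : R) (x0 : 'cV[R]_d) (u : nat -> T -> 'cV[R]_d) (t : nat)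
  (w : T) : 'cV[R]_d := (zo_gdm F mu beta eta x0 u t w).2.

Definition mean_bounded {dT : measure_display} {T : measurableType dT}
    {R : realType} (P : probability T R) {d : nat} (F : 'cV[R]_d -> R)
    (mu beta eta : R) (xstar x0 : 'cV[R]_d) (u : nat -> T -> 'cV[R]_d) : Prop :=
  exists M : R, forall t,
    (forall i : 'I_d,
       'E_P[fun w => ((iterate F mu beta eta x0 u t w - xstar)%R i ord0)] \is a fin_num) /\
    (Num.sqrt (\sum_(i < d)
       (fine 'E_P[fun w => ((iterate F mu beta eta x0 u t w - xstar)%R i ord0)]) ^+ 2)
      <= M)%R.

Definition ms_bounded {dT : measure_display} {T : measurableType dT}
    {R : realType} (P : probability T R) {d : nat} (F : 'cV[R]_d -> R)
    (mu beta eta : R) (xstar x0 : 'cV[R]_d) (u : nat -> T -> 'cV[R]_d) : Prop :=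
  exists M : R, forall t,
    'E_P[fun w => sqnorm (iterate F mu beta eta x0 u t w - xstar)%R] <= M%:E.

Definition eta_mean {dT : measure_display} {T : measurableType dT}
    {R : realType} (P : probability T R) {d : nat} (F : 'cV[R]_d -> R)
    (mu beta : R) (xstar : 'cV[R]_d) (u : nat -> T -> 'cV[R]_d) : R :=
  sup [set eta : R | (0 < eta)%R /\
         forall x0, mean_bounded P F mu beta eta xstar x0 u].

Definition eta_ms {dT : measure_display} {T : measurableType dT}
    {R : realType} (P : probability T R) {d : nat} (F : 'cV[R]_d -> R)
    (mu beta : R) (xstar : 'cV[R]_d) (u : nat -> T -> 'cV[R]_d) : R :=
  sup [set eta : R | (0 < eta)%R /\
         forall x0, ms_bounded P F mu beta eta xstar x0 u].

End Prob.

Definition ms_condition {R : realType} {d : nat} (lam : 'I_d -> R) (beta eta : R) : Prop :=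
  (0 < eta /\ eta * lambda_max lam < 1 - beta ^+ 2 /\
   \sum_(i < d) (eta * lam i) /
      (2 * (1 - beta) * (1 - eta * lam i / (1 - beta ^+ 2))) = 1)%R.

(* Main.v *)
(* With [y = x - xstar] the two-point estimator is exactly [(u^T H y) u], so the
   iteration is linear with multiplicative noise.  In an orthonormal eigenbasis
   of [H], Wick's formula gives a closed recursion for the diagonal second
   moments [a_i = E y_i^2], [c_i = E y_i m_i], [b_i = E m_i^2], whose coordinates
   are coupled only through [s = sum_j lam_j^2 a_j].

   For each eigenvalue [l] there is a quadratic form [q] (see [lyap]) and a number
   [tau] with [q' = q - l tau a + noise], where [noise = l^2 a + s] for the second
   moments and [noise = 0] for the means.  Weighting [q_i] by the [i]-th term of
   the sum [g(eta)] in the critical equation gives [V' = V + (g(eta) - 1) s].  If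
   [g(eta) < 1] then [V >= 0] forces [sum_t s_t < oo], hence boundedness.  If
   [g(eta) > 1], or if [eta l_max >= 1 - beta^2] with [V] the top form alone, then
   [V] grows by at least a multiple of [s] while being bounded by a multiple of two
   consecutive values of [s], so [s] is unbounded.  With zero noise the same form
   changes sign at [eta l = 2 (1 + beta)], which settles the mean. *)

Require Import Defs.
From HB Require Import structures.
From mathcomp Require Import all_boot all_order all_algebra.
From mathcomp Require Import all_classical all_reals all_analysis.
From mathcomp Require Import measurable_realfun.
From mathcomp Require Import ring lra.
Import Order.TTheory GRing.Theory Num.Theory.
Import numFieldNormedType.Exports.
Local Open Scope classical_set_scope.
Local Open Scope ring_scope.
Set Implicit Arguments.
Unset Strict Implicit.
Unset Printing Implicit Defensive.

(** * Orthogonal diagonalization of symmetric matrices *)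

(** The critical equation is built into the forms. [lyap] is chosen so that the noiseless momentum
    map dissipates a multiple of [a] alone, and its scale is fixed by the direction in which noise
    enters; the [i]-th term of the critical sum is then exactly [l / (tau - l)]. As a weight it
    turns the net dissipation [l (tau - l) a] into [l^2 a], the [i]-th summand of [s], so the
    coupled system collapses to a scalar identity and no spectral radius is computed. A supremum
    does not see its own threshold, so only strict inequalities on either side are treated. The
    blind spot is a null eigenvalue: its weight is zero and [s] ignores it, so its boundedness needs
    a separate argument. On the probabilistic side, independence is given in the standard basis
    while the recursion lives in the eigenbasis. Instead of invoking rotation invariance of the
    Gaussian law, rotated coordinates are expanded and contracted with [Q^T *m Q = 1%:M]. *)

Section RealSpectral.
Variable R : rcfType.

Lemma char_poly_conj n (W A : 'M[R]_n) :
  W *m W^T = 1%:M -> char_poly (W *m A *m W^T) = char_poly A.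
Proof.
move=> WW; rewrite /char_poly.
have WWp : map_mx polyC W *m map_mx polyC W^T = 1%:M.
  by rewrite -map_mxM WW map_mx1.
have -> : char_poly_mx (W *m A *m W^T) =
    map_mx polyC W *m char_poly_mx A *m map_mx polyC W^T.
  rewrite /char_poly_mx mulmxBr mulmxBl !map_mxM; congr (_ - _).
  by rewrite scalar_mxC -mulmxA WWp mulmx1.
by rewrite !det_mulmx mulrAC -det_mulmx WWp det1 mul1r.
Qed.

Lemma row_sqnorm_gt0 n (v : 'rV[R]_n) : v != 0 -> 0 < (v *m v^T) 0 0.
Proof.
have -> : (v *m v^T) 0 0 = \sum_j v 0 j ^+ 2.
  by rewrite mxE; apply: eq_bigr => j _; rewrite [v^T _ _]mxE expr2.
move=> v0; rewrite lt_neqAle sumr_ge0 ?andbT => [|j _]; last exact: sqr_ge0.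
apply: contraNneq v0 => /esym/psumr_eq0P; move=> /(_ (fun i _ => sqr_ge0 _)) vj.
by apply/eqP/rowP => j; rewrite mxE; apply/eqP; rewrite -sqrf_eq0 vj.
Qed.

(** The reflection along [v - e], with [e] the first basis row, exchanges [e] and [v], so its row 0
    is [v]. For [v = e] the reflection degenerates and the identity serves. *)
Lemma householder n (v : 'rV[R]_n.+1) : v *m v^T = 1%:M ->
  exists W : 'M[R]_n.+1, W *m W^T = 1%:M /\ row 0 W = v.
Proof.
move=> vv; pose e : 'rV[R]_n.+1 := delta_mx 0 0.
have vvE : (v *m v^T) 0 0 = 1 by rewrite vv mxE.
have eeE : (e *m e^T) 0 0 = 1.
  by rewrite /e trmx_delta mul_delta_mx mxE.
have [->|ve] := eqVneq v e.
  exists 1%:M; split; first by rewrite trmx1 mulmx1.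
  by rewrite row1.
pose w := v - e; pose g := (w *m w^T) 0 0.
have wwE : w *m w^T = g%:M by rewrite [LHS]mx11_scalar.
have g0 : g != 0 by rewrite gt_eqF // row_sqnorm_gt0 // subr_eq0.
have evE : (e *m v^T) 0 0 = (v *m e^T) 0 0.
  by rewrite -{1}(trmxK e) -trmx_mul mxE.
have subE (X Y : 'M[R]_1) : (X - Y) 0 0 = X 0 0 - Y 0 0 by rewrite !mxE.
have gE : g = 2 - 2 * (v *m e^T) 0 0.
  by rewrite /g /w linearB /= mulmxBr !mulmxBl !subE vvE eeE evE; ring.
pose S := w^T *m w; pose W : 'M[R]_n.+1 := 1%:M - (2 / g) *: S.
have SS : S *m S = g *: S.
  by rewrite /S mulmxA -(mulmxA w^T w) wwE -mulmxA mul_scalar_mx -scalemxAr.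
have Wt : W^T = W.
  apply/matrixP => i j; rewrite !mxE eq_sym; congr (_ - _ * _).
  by apply: eq_bigr => k _; rewrite mulrC !mxE.
exists W; split.
  rewrite Wt /W mulmxBr mulmx1 mulmxBl mul1mx -scalemxAl -scalemxAr SS !scalerA.
  rewrite (_ : 2 / g * (2 / g) * g = 2 / g + 2 / g); last by field.
  rewrite scalerDl; set X := _ *: _.
  have -> : X - (X + X) = - X by rewrite opprD addrA subrr add0r.
  by rewrite opprK subrK.
have ew : e *m w^T = ((v *m e^T) 0 0 - 1)%:M.
  rewrite [LHS]mx11_scalar; congr _%:M.
  by rewrite /w linearB /= mulmxBr subE evE eeE.
rewrite rowE -/e mulmxBr mulmx1 -scalemxAr mulmxA ew mul_scalar_mx scalerA.
(* By [gE] the second factor is [- g / 2]. *)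
rewrite (_ : _ * _ = -1); last by rewrite gE in g0 *; field.
by rewrite scaleN1r opprK addrC subrK.
Qed.

Lemma block_of_row0 n (B : 'M[R]_(1 + n)) (x : R) : B^T = B ->
  (forall j, B 0 j = x *+ (j == 0)) -> B = block_mx x%:M 0 0 (drsubmx B).
Proof.
move=> Bt B0j; apply/matrixP => i j; rewrite !mxE.
case: (splitP i) => i' ii; rewrite mxE; case: (splitP j) => j' jj; rewrite !mxE.
- have -> : i = 0 by apply/val_inj; rewrite /= ii (ord1 i').
  have -> : j = 0 by apply/val_inj; rewrite /= jj (ord1 j').
  by rewrite B0j eqxx (ord1 i') (ord1 j').
- have -> : i = 0 by apply/val_inj; rewrite /= ii (ord1 i').
  by rewrite B0j -val_eqE /= jj.
- have -> : j = 0 by apply/val_inj; rewrite /= jj (ord1 j').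
  by rewrite -Bt mxE B0j -val_eqE /= ii.
- by congr (B _ _); apply/val_inj.
Qed.

(** Deflation: a unit eigenvector for [l ord0] becomes row 0 of an orthogonal [W], symmetry clears
    column 0 of [W *m A *m W^T], and the factor of [l ord0] cancels from the characteristic
    polynomial of the remaining block. The eigenvalues thus appear in the prescribed order. *)
Lemma symmetric_diagonalization n (A : 'M[R]_n) (l : 'I_n -> R) :
  A^T = A -> char_poly A = \prod_(i < n) ('X - (l i)%:P) ->
  exists Q : 'M[R]_n,
    Q^T *m Q = 1%:M /\ Q^T *m A *m Q = diag_mx (\row_i l i).
Proof.
elim: n A l => [|n IH] A l At Al.
  by exists 1%:M; rewrite [LHS]flatmx0 [RHS]flatmx0; split=> //;
    rewrite [LHS]flatmx0 [RHS]flatmx0.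
have : eigenvalue A (l ord0).
  by rewrite eigenvalue_root_char Al big_ord_recl rootM root_XsubC eqxx.
move=> /eigenvalueP[v0 vA v00].
pose g := (v0 *m v0^T) 0 0.
have g_gt0 : 0 < g by exact: row_sqnorm_gt0.
pose v := (Num.sqrt g)^-1 *: v0.
have vv : v *m v^T = 1%:M.
  rewrite /v linearZ /= -scalemxAl -scalemxAr scalerA -invfM -expr2.
  rewrite sqr_sqrtr ?ltW // [v0 *m _]mx11_scalar -/g scale_scalar_mx.
  by rewrite mulVf // gt_eqF.
have {}vA : v *m A = l ord0 *: v.
  by rewrite /v -scalemxAl vA scalerA mulrC -scalerA.
have [W [WW Wv]] := householder vv.
have WW' : W^T *m W = 1%:M by exact: mulmx1C.
pose B : 'M[R]_(1 + n) := W *m A *m W^T.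
have Bt : B^T = B by rewrite /B !trmx_mul trmxK At mulmxA.
have B0 : row 0 B = l ord0 *: delta_mx 0 0.
  rewrite /B !row_mul Wv vA -scalemxAl -Wv -row_mul WW; congr (_ *: _).
  by rewrite row1.
have B0j j : B 0 j = l ord0 *+ (j == 0).
  by move/rowP: B0 => /(_ j); rewrite !mxE /= mulr_natr.
have BE := block_of_row0 Bt B0j.
set B' := drsubmx B in BE.
have B't : B'^T = B' by rewrite /B' trmx_drsub Bt.
have [Q' [QQ' Q'B]] : exists Q : 'M[R]_n, Q^T *m Q = 1%:M /\
    Q^T *m B' *m Q = diag_mx (\row_i l (lift ord0 i)).
  apply: IH => //.
  have : char_poly B = char_poly A by exact: char_poly_conj.
  rewrite {1}BE Al big_ord_recl /char_poly char_block_diag_mx det_ublock.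
  rewrite {1}/char_poly_mx det_mx11 !mxE /= mulr1n => /mulfI; apply.
  by rewrite polyXsubC_eq0.
pose Q1 : 'M[R]_(1 + n) := block_mx 1%:M 0 0 Q'.
have Q1t : Q1^T = block_mx 1%:M 0 0 Q'^T.
  by rewrite /Q1 tr_block_mx trmx1 !trmx0.
have Q1Q : Q1^T *m Q1 = 1%:M.
  rewrite Q1t /Q1 mulmx_block !mulmx0 !mul0mx !addr0 !add0r mulmx1 QQ'.
  by rewrite -scalar_mx_block.
have Q1B : Q1^T *m B *m Q1 = diag_mx (\row_(i < 1 + n) l i).
  rewrite BE Q1t /Q1 !mulmx_block !mulmx0 !mul0mx !addr0 !add0r.
  rewrite ?mulmx0 ?mul0mx mulmx1 mul1mx Q'B.
  have -> : \row_(i < 1 + n) l i =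
      row_mx (\row_(i < 1) l ord0) (\row_i l (lift ord0 i)).
    apply/rowP => i; rewrite !mxE; case: splitP => j ij; rewrite mxE; congr l;
      by apply/val_inj; rewrite /= ij ?(ord1 j).
  rewrite diag_mx_row; congr block_mx.
  by apply/matrixP => i j; rewrite !mxE (ord1 i) (ord1 j).
exists (W^T *m Q1); split.
  by rewrite trmx_mul trmxK mulmxA -(mulmxA _ W) WW mulmx1; exact: Q1Q.
by rewrite trmx_mul trmxK -[RHS]Q1B /B !mulmxA.
Qed.

End RealSpectral.

(** * The critical equation *)

Section CriticalStep.
Variables (R : realType) (d : nat) (lam : 'I_d -> R) (beta : R).
Hypotheses (lam_ge0 : forall i, 0 <= lam i) (b0 : 0 <= beta) (b1 : beta < 1).

Definition ms_term (eta : R) (i : 'I_d) : R :=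
  eta * lam i / (2 * (1 - beta) * (1 - eta * lam i / (1 - beta ^+ 2))).

Lemma le_lambda_max i : lam i <= lambda_max lam.
Proof. exact: le_bigmax. Qed.

(** The default value 0 inside [lambda_max] is harmless: the eigenvalues are nonnegative and one is
    nonzero. *)
Lemma lambda_max_attained : (exists i, lam i != 0) ->
  0 < lambda_max lam /\ exists i, lambda_max lam = lam i.
Proof.
move=> [i li]; have li0 : 0 < lam i by rewrite lt_neqAle eq_sym li lam_ge0.
split; first exact: lt_le_trans li0 (le_lambda_max i).
exists [arg max_(j > i) lam j]%O; case: arg_maxP => // j _ jmax.
apply/le_anti; rewrite le_lambda_max andbT.
by apply: bigmax_le => // k _; exact: jmax.
Qed.

Local Ltac lrab := move: (b0) (b1) => ? ?; lra.

Let c0 : 0 < 1 - beta ^+ 2.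
Proof. by rewrite subr_gt0 expr_lt1. Qed.

Lemma ms_den_gt0 eta i : 0 <= eta -> eta * lambda_max lam < 1 - beta ^+ 2 ->
  0 < 1 - eta * lam i / (1 - beta ^+ 2).
Proof.
move=> e0 el; rewrite subr_gt0 ltr_pdivrMr // mul1r.
by apply: le_lt_trans el; rewrite ler_wpM2l // le_lambda_max.
Qed.

Lemma ms_term_ge0 eta i : 0 <= eta -> eta * lambda_max lam < 1 - beta ^+ 2 ->
  0 <= ms_term eta i.
Proof.
move=> e0 el; have := ms_den_gt0 i e0 el => h.
by rewrite divr_ge0 ?mulr_ge0 // ?(ltW h) // subr_ge0 ltW.
Qed.

Lemma ms_term_lt eta eta' i : 0 < lam i -> 0 <= eta -> eta < eta' ->
  eta' * lambda_max lam < 1 - beta ^+ 2 -> ms_term eta i < ms_term eta' i.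
Proof.
move=> li0 e0 ee el'.
have e'0 : 0 <= eta' by lrab.
have el : eta * lambda_max lam < 1 - beta ^+ 2.
  apply: le_lt_trans el'; rewrite ler_wpM2r ?(ltW ee) //.
  exact: le_trans (lam_ge0 i) (le_lambda_max i).
have h := ms_den_gt0 i e0 el; have h' := ms_den_gt0 i e'0 el'.
have q0 : 0 < 2 * (1 - beta) by rewrite mulr_gt0 // subr_gt0.
rewrite /ms_term (ltr_pdivrMr _ _ (mulr_gt0 q0 h)) [ltRHS]mulrAC.
rewrite (ltr_pdivlMr _ _ (mulr_gt0 q0 h')).
rewrite !(mulrCA _ (2 * (1 - beta))) ltr_pM2l //.
(* After cross-multiplication the products of the two step sizes agree on both sides;
   [eta * lam i < eta' * lam i] is left. *)
rewrite !mulrBr !mulr1 (_ : eta' * lam i * (eta * lam i / _) =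
  eta * lam i * (eta' * lam i / (1 - beta ^+ 2))); last by ring.
by rewrite ltrD2r ltr_pM2r.
Qed.

Lemma ms_term_le eta eta' i : 0 <= eta -> eta <= eta' ->
  eta' * lambda_max lam < 1 - beta ^+ 2 -> ms_term eta i <= ms_term eta' i.
Proof.
move=> e0; rewrite le_eqVlt => /predU1P[->//|ee el].
have := lam_ge0 i; rewrite le_eqVlt => /predU1P[l0|l0].
  by rewrite /ms_term -l0 !mulr0 !mul0r.
exact/ltW/ms_term_lt.
Qed.

Hypothesis lam_n0 : exists i, lam i != 0.

Let lmax_gt0 : 0 < lambda_max lam.
Proof. by case: (lambda_max_attained lam_n0). Qed.

Lemma ms_sum_lt eta eta' : 0 <= eta -> eta < eta' ->
  eta' * lambda_max lam < 1 - beta ^+ 2 ->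
  \sum_i ms_term eta i < \sum_i ms_term eta' i.
Proof.
move=> e0 ee el; have [_ [i lE]] := lambda_max_attained lam_n0.
rewrite (bigD1 i) //= [ltRHS](bigD1 i) //= ltr_leD //.
  by apply: ms_term_lt => //; rewrite -lE.
by apply: ler_sum => j _; apply: ms_term_le => //; exact: ltW.
Qed.

Lemma ms_condition_exists : exists eta, ms_condition lam beta eta.
Proof.
have [_ [k lE]] := lambda_max_attained lam_n0.
(* The step at which the term of the largest eigenvalue alone equals 1, so that the whole sum is at
   least 1. Since [2 / (3 + beta) < 1], no pole lies in [[0, e1]] and the intermediate value theorem
   applies there. *)
pose e1 := 2 * (1 - beta) * (1 + beta) / ((3 + beta) * lambda_max lam).
have q0 : 0 < 3 + beta by lrab.
have e1l : e1 * lambda_max lam = 2 * (1 - beta) * (1 + beta) / (3 + beta).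
  by rewrite /e1; field; rewrite !gt_eqF.
have e10 : 0 < e1.
  by rewrite /e1 divr_gt0 ?mulr_gt0 //; lrab.
have e1lt : e1 * lambda_max lam < 1 - beta ^+ 2.
  rewrite e1l ltr_pdivrMr //.
  have -> : 1 - beta ^+ 2 = (1 - beta) * (1 + beta) by ring.
  rewrite -mulrA mulrC ltr_pM2l ?mulr_gt0 //; lrab.
have elt x : x \in `[0, e1] -> x * lambda_max lam < 1 - beta ^+ 2.
  rewrite in_itv /= => /andP[x0 xe]; apply: le_lt_trans e1lt.
  by rewrite ler_wpM2r // ltW.
have e1k : ms_term e1 k = 1.
  rewrite /ms_term -lE e1l; field.
  have -> : (3 + beta) * (1 - beta ^+ 2) - 2 * (1 - beta) * (1 + beta) =
    (1 - beta ^+ 2) * (1 + beta) by ring.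
  by rewrite mulf_neq0 !gt_eqF //; lrab.
have sum1 : 1 <= \sum_i ms_term e1 i.
  rewrite (bigD1 k) //= e1k lerDl sumr_ge0 // => i _.
  by rewrite ms_term_ge0 // ltW.
have sum0 : \sum_i ms_term 0 i = 0.
  by rewrite big1 // => i _; rewrite /ms_term !mul0r.
have cont : {within `[0, e1], continuous (fun x => \sum_i ms_term x i)}.
  apply: continuous_in_subspaceT => x; rewrite inE /= => xe.
  apply: cvg_big => [|i _].
    by move=> [y z]; exact: (@add_continuous R^o).
  have x0 : 0 <= x by move: xe; rewrite in_itv /= => /andP[].
  apply: cvgM; first by apply: cvgM => //; exact: cvg_cst.
  apply: cvgV.
    by rewrite mulf_neq0 ?gt_eqF //; [lrab | exact: ms_den_gt0 (elt _ xe)].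
  apply: cvgM; first exact: cvg_cst.
  apply: cvgB; first exact: cvg_cst.
  by apply: cvgM; [apply: cvgM => //; exact: cvg_cst | exact: cvg_cst].
have [|c ce cE] := @IVT _ (fun x => \sum_i ms_term x i) _ _ 1 (ltW e10) cont.
  by rewrite /= sum0 min_l ?max_r ?ler01 ?(le_trans ler01 sum1).
exists c; split; last by split=> //; exact: elt.
have : 0 <= c by move: ce; rewrite in_itv /= => /andP[].
rewrite le_eqVlt => /predU1P[c00|//]; move: cE; rewrite -c00 sum0 => /eqP.
by rewrite eq_sym oner_eq0.
Qed.

Lemma ms_condition_uniq eta eta' :
  ms_condition lam beta eta -> ms_condition lam beta eta' -> eta = eta'.
Proof.
wlog le : eta eta' / eta <= eta'.
  by case: (leP eta eta') => [/[swap]/[apply]//|/ltW le H h h']; apply/esym/H.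
move=> [e0 [el eE]] [e'0 [el' eE']]; move: le; rewrite le_eqVlt => /predU1P[//|ee].
by have := ms_sum_lt (ltW e0) ee el'; rewrite /ms_term eE eE' ltxx.
Qed.

(** The factors [1 - eta * lam i / (1 - beta ^+ 2)] are at most 1; dropping them makes the critical
    equation linear in [eta]. *)
Lemma ms_condition_upper eta : ms_condition lam beta eta ->
  eta <= 2 * (1 - beta) / \sum_i lam i.
Proof.
move=> [e0 [el eE]].
have s0 : 0 < \sum_i lam i.
  have [i li] := lam_n0; rewrite (bigD1 i) //= ltr_pwDl ?sumr_ge0 //.
  by rewrite lt_neqAle eq_sym li lam_ge0.
have q0 : 0 < 2 * (1 - beta) by lrab.
have -> : 2 * (1 - beta) = \sum_i 2 * (1 - beta) * ms_term eta i.
  by rewrite -mulr_sumr eE mulr1.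
rewrite ler_pdivlMr // mulr_sumr ler_sum // => i _.
have h := ms_den_gt0 i (ltW e0) el.
have -> : 2 * (1 - beta) * ms_term eta i =
    eta * lam i / (1 - eta * lam i / (1 - beta ^+ 2)).
  rewrite /ms_term; move: h; set D := 1 - _ / _ => h.
  by field; rewrite !gt_eqF //; lrab.
rewrite ler_pdivlMr // -[leRHS]mulr1 ler_wpM2l ?mulr_ge0 ?(ltW e0) // gerBl.
by rewrite divr_ge0 ?mulr_ge0 ?(ltW e0) ?(ltW c0).
Qed.

(** Replacing every denominator by the smallest one, that of the largest eigenvalue, again gives an
    inequality linear in [eta]; the correction to the trace comes from that denominator. *)
Lemma ms_condition_lower eta : ms_condition lam beta eta ->
  2 * (1 - beta) / (\sum_i lam i + 2 * lambda_max lam / (1 + beta)) <= eta.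
Proof.
move=> [e0 [el eE]].
have q0 : 0 < 2 * (1 - beta) by rewrite mulr_gt0 // subr_gt0.
have s0 : 0 <= \sum_i lam i by rewrite sumr_ge0.
have r0 : 0 < 2 * lambda_max lam / (1 + beta) by rewrite divr_gt0 ?mulr_gt0 //; lrab.
rewrite ler_pdivrMr; last by lrab.
pose D := 1 - eta * lambda_max lam / (1 - beta ^+ 2).
have D0 : 0 < D by rewrite subr_gt0 ltr_pdivrMr // mul1r.
have : 1 <= \sum_i eta * lam i / (2 * (1 - beta) * D).
  rewrite -[X in X <= _]eE ler_sum // => i _; rewrite ler_wpM2l ?mulr_ge0 ?(ltW e0) //.
  have h := ms_den_gt0 i (ltW e0) el.
  have qh := mulr_gt0 q0 h; have qD := mulr_gt0 q0 D0.
  rewrite lef_pV2 ?posrE // ler_pM2l // lerD2l lerN2 ler_pM2r ?invr_gt0 //.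
  by rewrite ler_pM2l // le_lambda_max.
rewrite -mulr_suml (ler_pdivlMr _ _ (mulr_gt0 q0 D0)) mul1r -mulr_sumr => h.
have : 2 * (1 - beta) * D = 2 * (1 - beta) - eta * (2 * lambda_max lam / (1 + beta)).
  rewrite /D; field; rewrite !gt_eqF //; lrab.
by move=> DE; rewrite [leRHS]mulrDr -lerBlDr -DE.
Qed.

End CriticalStep.

(** * Lyapunov forms *)

Section Lyapunov.
Variable R : realFieldType.
Implicit Types (beta eta l a b c y z : R).

(** For [0 <= beta < 1] and [0 < eta], this is positive exactly when [eta l < 2 (1 + beta)], the
    mean threshold, and exceeds [l] exactly when [eta l < 1 - beta^2], the constraint of the
    critical equation. *)
Definition lyap_tau beta eta l := (1 - beta) * (2 / eta - l / (1 + beta)).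

Definition lyap_rho beta eta l := (l - lyap_tau beta eta l) / 2.

Definition lyap_p beta eta l :=
  (l * (1 + beta) + lyap_tau beta eta l * (1 - beta)) / (2 * eta).

(* The quadratic form [y, m |-> lyap_p y^2 + 2 lyap_rho beta y m + beta^2 m^2],
   evaluated on second moments [a = E y^2], [c = E y m], [b = E m^2].  It takes
   the value 1 at [(- eta, 1)], the direction in which the noise enters. *)
Definition lyap beta eta l a c b :=
  lyap_p beta eta l * a + 2 * (lyap_rho beta eta l * beta) * c + beta ^+ 2 * b.

(** The new moments are those of [m' = beta m + l y + xi], [y' = y - eta m'], with [xi] centred,
    uncorrelated with the state and of variance [noise]. The noise passes with coefficient 1 because
    the form is 1 at [(- eta, 1)]. *)
Lemma lyap_step beta eta l a c b noise :
  0 <= beta -> 0 < eta ->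
  let b' := beta ^+ 2 * b + 2 * beta * l * c + l ^+ 2 * a + noise in
  let cc := beta * c + l * a in
  lyap beta eta l (a - 2 * eta * cc + eta ^+ 2 * b') (cc - eta * b') b' =
  lyap beta eta l a c b - l * lyap_tau beta eta l * a + noise.
Proof.
move=> b0 e0 /=; rewrite /lyap /lyap_p /lyap_rho /lyap_tau.
by field; apply/andP; split; apply: lt0r_neq0; lra.
Qed.

Lemma lyap_tau_sub beta eta l : 0 <= beta -> 0 < eta ->
  eta * (lyap_tau beta eta l - l) * (1 + beta) = 2 * (1 - beta ^+ 2 - eta * l).
Proof.
move=> b0 e0; rewrite /lyap_tau.
by field; apply/andP; split; apply: lt0r_neq0; lra.
Qed.

(** There is no upper bound on [eta]: the form must start positive, at zero momentum, in the
    unstable regime too. *)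
Lemma lyap_p_gt0 beta eta l : 0 <= beta -> beta < 1 -> 0 < eta -> 0 <= l ->
  0 < lyap_p beta eta l.
Proof.
move=> b0 b1 e0 l0; rewrite /lyap_p divr_gt0 ?(mulr_gt0 _ e0) //.
have -> : l * (1 + beta) + lyap_tau beta eta l * (1 - beta) =
  (4 * beta * l) / (1 + beta) + 2 * (1 - beta) ^+ 2 / eta.
  rewrite /lyap_tau.
  by field; apply/andP; split; apply: lt0r_neq0; lra.
apply: ltr_wpDl; first by rewrite divr_ge0 ?mulr_ge0 //; lra.
by rewrite divr_gt0 // mulr_gt0 // exprn_gt0 //; lra.
Qed.

(** The determinant of the form is [beta^2 (p - rho^2)], so this is the range in which the form is
    nonnegative. *)
Lemma lyap_rho_le beta eta l : 0 <= beta -> 0 < eta -> 0 <= l ->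
  eta * l <= 2 * (1 + beta) -> lyap_rho beta eta l ^+ 2 <= lyap_p beta eta l.
Proof.
move=> b0 e0 l0 el; rewrite -subr_ge0.
have -> : lyap_p beta eta l - lyap_rho beta eta l ^+ 2 =
  l * (2 * (1 + beta) - eta * l) / (eta * (1 + beta) ^+ 2).
  rewrite /lyap_p /lyap_rho /lyap_tau.
  by field; apply/andP; split; apply: lt0r_neq0; lra.
by apply: divr_ge0; rewrite mulr_ge0 ?sqr_ge0 ?(ltW e0) ?subr_ge0.
Qed.

Lemma lyap_ge0 beta eta l a c b : 0 <= beta -> 0 < eta -> 0 <= l -> 0 <= a ->
  (forall y z, 0 <= y ^+ 2 * a + 2 * (y * z) * c + z ^+ 2 * b) ->
  eta * l <= 2 * (1 + beta) -> 0 <= lyap beta eta l a c b.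
Proof.
move=> b0 e0 l0 a0 psd el.
have rp := lyap_rho_le b0 e0 l0 el.
(* Completing the square: the second summand is [E (rho y + beta m)^2]. *)
have -> : lyap beta eta l a c b =
  (lyap_p beta eta l - lyap_rho beta eta l ^+ 2) * a +
  (lyap_rho beta eta l ^+ 2 * a + 2 * (lyap_rho beta eta l * beta) * c +
   beta ^+ 2 * b) by rewrite /lyap; ring.
by rewrite addr_ge0 // mulr_ge0 // subr_ge0.
Qed.

(* [a] and [a'] are the values of [E y^2] before and after a step
   [y' = y - eta m']; the momentum [eta m' = y - y'] is controlled by both. *)
Lemma lyap_le beta eta l a a' c' b' : 0 <= beta -> beta < 1 -> 0 < eta -> 0 <= l ->
  0 <= a -> 0 <= a' -> 0 <= b' -> 0 <= 4 * a' + 4 * eta * c' + eta ^+ 2 * b' ->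
  a = a' + 2 * eta * c' + eta ^+ 2 * b' ->
  lyap beta eta l a' c' b' <=
  (lyap_p beta eta l + 3 * `|lyap_rho beta eta l * beta| / eta +
    2 * beta ^+ 2 / eta ^+ 2) * (a + a').
Proof.
move=> b0 b1 e0 l0 a0 a'0 b'0 psd aE.
have p0 := lyap_p_gt0 b0 b1 e0 l0.
have e2 : 0 < eta ^+ 2 by rewrite exprn_gt0.
(* Parallelogram identity: [eta m' = y - y'], [psd] says [E (y + y')^2 >= 0], and the two squares
   add up to [2 (a + a')]. *)
have b'le : eta ^+ 2 * b' <= 2 * (a + a') by lra.
have b'le2 : beta ^+ 2 * b' <= 2 * beta ^+ 2 / eta ^+ 2 * (a + a').
  rewrite [leRHS](_ : _ = beta ^+ 2 * (2 * (a + a') / eta ^+ 2)); last by ring.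
  by rewrite ler_wpM2l ?sqr_ge0 // ler_pdivlMr // mulrC.
(* The 3 comes from [2 eta c' = a - a' - eta^2 b'] and the bound on [eta^2 b']. *)
have cle : 2 * (lyap_rho beta eta l * beta) * c' <=
    3 * `|lyap_rho beta eta l * beta| / eta * (a + a').
  set r := lyap_rho beta eta l * beta.
  apply: le_trans (ler_norm _) _; rewrite normrM normrM (ger0_norm (_ : 0 <= 2)) //.
  rewrite [leRHS](_ : _ = `|r| * (3 * (a + a') / eta)); last by ring.
  rewrite [leLHS](_ : _ = `|r| * (2 * `|c'|)); last by ring.
  apply: ler_wpM2l => //; rewrite ler_pdivlMr //.
  have -> : 2 * `|c'| * eta = `|2 * eta * c'|.
    by rewrite !normrM (gtr0_norm e0) ger0_norm //; ring.
  by rewrite ler_norml; apply/andP; split; nra.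
have ple : lyap_p beta eta l * a' <= lyap_p beta eta l * (a + a').
  by rewrite ler_wpM2l ?(ltW p0) //; lra.
rewrite /lyap !mulrDl; lra.
Qed.

End Lyapunov.

(** A bound on [s] would bound [V]. But [V] never falls below [V 0], which keeps [s t + s t.+1] away
    from 0, so [V] gains a fixed amount every two steps. *)
Lemma unbounded_growth (R : archiRealFieldType) (V s : nat -> R) (eps K M : R) :
  0 < eps -> 0 <= K -> 0 < V 0 -> (forall t, 0 <= s t) ->
  (forall t, V t + eps * s t <= V t.+1) ->
  (forall t, V t.+1 <= K * (s t + s t.+1)) ->
  exists t, M < s t.
Proof.
move=> e0 K0 V0 s0 Vs sV.
apply: contrapT => /forallNP sM.
have {}sM t : s t <= M by rewrite leNgt; apply/negP; exact: sM.
have Vmon t : V 0 <= V t.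
  elim: t => // t /le_trans; apply; apply: le_trans (Vs t).
  by rewrite lerDl mulr_ge0 // ltW.
(* A positive divisor even when [K = 0]. *)
pose K1 := K + 1.
have K1p : 0 < K1 by rewrite /K1; lra.
have V2 t : V t + eps / K1 * V 0 <= V t.+2.
  have h1 := Vs t; have h2 := Vs t.+1.
  have h3 : V 0 <= K1 * (s t + s t.+1).
    apply: le_trans (Vmon t.+1) _; apply: le_trans (sV t) _.
    by rewrite ler_wpM2r ?addr_ge0 // /K1; lra.
  have h4 : eps / K1 * V 0 <= eps * (s t + s t.+1).
    rewrite -mulrA ler_pM2l // mulrC ler_pdivrMr //; lra.
  lra.
have Vlin n : eps / K1 * V 0 * n%:R <= V n.*2.
  elim: n => [|n IH]; first by rewrite mulr0 ltW.
  rewrite doubleS -natr1 mulrDr mulr1; have := V2 n.*2; lra.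
have c0 : 0 < eps / K1 * V 0 by rewrite mulr_gt0 // divr_gt0.
have VM t : V t.+1 <= K * (2 * M).
  by apply: le_trans (sV t) _; rewrite ler_wpM2l // mulr_natl mulr2n lerD.
pose n := Num.bound `|K * (2 * M) / (eps / K1 * V 0)|.
have : K * (2 * M) / (eps / K1 * V 0) < n.+1%:R.
  apply: lt_trans (_ : n%:R < _); last by rewrite ltr_nat.
  exact: le_lt_trans (ler_norm _) (archi_boundP (normr_ge0 _)).
rewrite ltr_pdivrMr // mulrC.
have := Vlin n.+1; have := VM n.*2.+1; rewrite doubleS; lra.
Qed.

(** * Gaussian moments *)

Section GaussianMoments.
Variable R : realType.
Local Notation mu := (@lebesgue_measure R).
Local Notation phi := (normal_pdf (0 : R) 1).

Lemma std_normal_pdfE (x : R) :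
  phi x = normal_peak 1 * expR (- (x ^+ 2 / 2)).
Proof.
by rewrite normal_pdfE ?oner_eq0 // /normal_fun subr0 expr1n mulNr.
Qed.

(** The Radon-Nikodym derivative and the explicit density have equal integrals over every measurable
    set, hence agree almost everywhere. *)
Lemma integral_normal_prob_ge0 (f : R -> \bar R) : (forall x, 0 <= f x)%E ->
  measurable_fun setT f ->
  (\int[normal_prob 0%R 1%R]_x f x = \int[mu]_x (f x * (phi x)%:E))%E.
Proof.
move=> f0 mf.
have dom := normal_prob_dominates (0 : R) 1.
rewrite -(Radon_Nikodym_SigmaFinite.change_of_variables dom) //.
apply: ae_eq_integral => //.
- apply: emeasurable_funM => //.
  exact: measurable_int (Radon_Nikodym_SigmaFinite.f_integrable dom).
- apply: emeasurable_funM => //; apply/measurable_EFinP.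
  exact: measurable_normal_pdf.
- apply: ae_eqe_mul2l => /=; apply: integral_ae_eq => //.
  + exact: Radon_Nikodym_SigmaFinite.f_integrable.
  + by apply/measurable_EFinP; exact: measurable_normal_pdf.
  + by move=> E _ mE; rewrite -Radon_Nikodym_SigmaFinite.f_integral.
Qed.

Lemma integral_normal_prob (f : R -> \bar R) :
  (normal_prob 0%R 1%R).-integrable setT f ->
  (\int[normal_prob 0%R 1%R]_x f x = \int[mu]_x (f x * (phi x)%:E))%E.
Proof.
move=> fi; have dom := normal_prob_dominates (0 : R) 1.
rewrite -(Radon_Nikodym_change_of_variables dom) //.
apply: ae_eq_integral => //.
- by apply: emeasurable_funM => //; exact: measurable_int fi.
- apply: emeasurable_funM => //; first exact: measurable_int fi.
  by apply/measurable_EFinP; exact: measurable_normal_pdf.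
- apply: ae_eqe_mul2l => /=; apply: integral_ae_eq => //.
  + exact: Radon_Nikodym_integrable.
  + by apply/measurable_EFinP; exact: measurable_normal_pdf.
  + by move=> E _ mE; rewrite -Radon_Nikodym_integral.
Qed.

(** [(x^2/4)^n / n!] is one term of the series of [expR (x^2/4)]; with [y <= 1 + y^2] this covers
    odd powers too. Spending only half of the Gaussian exponent leaves an integrable
    [expR (- (x^2/4))]. *)
Lemma normX_le_expR (n : nat) (x : R) :
  `|x ^+ n| <= (1 + 4 ^+ n * n`!%:R) * expR (x ^+ 2 / 4).
Proof.
have x0 : 0 <= x ^+ 2 / 4 by rewrite divr_ge0 ?sqr_ge0 ?ler0n.
have e1 : 1 <= expR (x ^+ 2 / 4) by rewrite -[leLHS]expR0 ler_expR.
have h : (x ^+ 2 / 4) ^+ n <= n`!%:R * expR (x ^+ 2 / 4).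
  case: n => [|n]; first by rewrite expr0 fact0 mul1r.
  rewrite [leRHS]mulrC -ler_pdivrMr ?ltr0n ?fact_gt0 //.
  by apply: le_trans (expR_ge1Dxn n x0); rewrite lerDr.
have h2 : (x ^+ n) ^+ 2 <= 4 ^+ n * n`!%:R * expR (x ^+ 2 / 4).
  rewrite -mulrA (_ : (x ^+ n) ^+ 2 = 4 ^+ n * (x ^+ 2 / 4) ^+ n).
    by rewrite ler_pM2l // exprn_gt0.
  by rewrite -exprMn mulrC divfK ?pnatr_eq0 // -!exprM mulnC.
rewrite mulrDl mul1r; apply: le_trans (_ : 1 + (x ^+ n) ^+ 2 <= _); last exact: lerD.
rewrite -(real_normK (num_real (x ^+ n))).
set y := `|_|; have : 0 <= (y - 1) ^+ 2 by exact: sqr_ge0.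
have : 0 <= y by exact: normr_ge0.
rewrite sqrrB mulr1 expr1n; lra.
Qed.

Lemma normX_mul_expR_le (n : nat) (x : R) :
  `|x ^+ n * expR (- (x ^+ 2 / 2))| <=
  (1 + 4 ^+ n * n`!%:R) * expR (- (x ^+ 2 / 4)).
Proof.
rewrite normrM (ger0_norm (expR_ge0 _)).
rewrite (_ : - (x ^+ 2 / 2) = - (x ^+ 2 / 4) - x ^+ 2 / 4); last by field.
rewrite expRD mulrA ler_wpM2r ?expR_ge0 //.
apply: le_trans (ler_wpM2r (expR_ge0 _) (normX_le_expR n x)) _.
by rewrite -mulrA -expRD subrr expR0 mulr1.
Qed.

Lemma integrable_expX (n : nat) :
  mu.-integrable setT (fun x : R => (x ^+ n * expR (- (x ^+ 2 / 2)))%:E).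
Proof.
(* With standard deviation [sqrt 2] the normal density is proportional to [expR (- (x^2/4))], an
   integrable bound. *)
pose s : R := Num.sqrt 2.
have s0 : s != 0 by rewrite gt_eqF // sqrtr_gt0.
have p0 : 0 < normal_peak s by exact: normal_peak_gt0.
pose C : R := (1 + 4 ^+ n * n`!%:R) / normal_peak s.
have iC : mu.-integrable setT (fun x : R => (C * normal_pdf 0 s x)%:E).
  have := integrableZl (mu := mu) measurableT C (integrable_normal_pdf (0:R) s).
  by [].
apply: (le_integrable measurableT _ _ iC).
  apply/measurable_EFinP; apply: measurable_funM => //.
  apply: measurableT_comp => //; apply: measurableT_comp => //.
  by apply: measurable_funM => //; exact: measurable_funX.
move=> x _ /=; rewrite lee_fin; apply: le_trans (normX_mul_expR_le n x) _.
apply: le_trans (ler_norm _).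
rewrite normal_pdfE // /normal_fun subr0 /s sqr_sqrtr // -/s /C mulrA divfK ?gt_eqF //.
by rewrite (_ : - x ^+ 2 / (2 *+ 2) = - (x ^+ 2 / 4)) //; field.
Qed.

(** [e] is 1 or -1, so both ends of the line are treated at once. *)
Lemma cvg_expX (n : nat) (e : R) : e ^+ 2 = 1 ->
  (e * k%:R) ^+ n * expR (- ((e * k%:R) ^+ 2 / 2)) @[k --> \oo] --> (0 : R).
Proof.
move=> e1; apply/norm_cvg0P.
pose C : R := 1 + 4 ^+ n * n`!%:R.
have C0 : 0 <= C by rewrite addr_ge0 // mulr_ge0 // exprn_ge0.
have lim0 : C * (expR (- (k%:R / 4)) : R) @[k --> \oo] --> (0 : R).
  rewrite -[X in _ --> X](mulr0 C); apply: cvgMr.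
  have -> : (fun k : nat => expR (- (k%:R / 4)) : R) =
    (fun k => (expR (- (1 / 4))) ^+ k).
    by apply/funext => k; rewrite -expRM_natl; congr expR; ring.
  by apply: cvg_expr; rewrite ger0_norm ?expR_ge0 // -[ltRHS]expR0 ltr_expR.
apply: (@squeeze_cvgr _ _ _ _ (fun=> 0) _ _ _ _ _ lim0); last exact: cvg_cst.
near=> k; rewrite normr_ge0 /=.
apply: le_trans (normX_mul_expR_le n _) _.
rewrite ler_wpM2l // ler_expR lerN2 exprMn e1 mul1r ler_wpM2r //.
rewrite -natrX ler_nat; case: (k) => // k'; by rewrite -mulnn leq_pmull.
Unshelve. all: by end_near. Qed.

Lemma integral_derivative_eq0 (f F : R -> R) :
  mu.-integrable setT (EFin \o f) -> continuous f ->
  (forall x, is_derive x (1 : R) F (f x)) ->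
  F k%:R @[k --> \oo] --> (0 : R) -> F (- k%:R) @[k --> \oo] --> (0 : R) ->
  (\int[mu]_x (f x)%:E = 0)%E.
Proof.
move=> fi fc dF Fp Fm.
(* The index [k.+1] keeps the interval nondegenerate. *)
have FTC (k : nat) : (\int[mu]_(x in `[(- k.+1%:R)%R, k.+1%:R]) (f x)%:E =
    (F k.+1%:R - F (- k.+1%:R))%:E)%E.
  rewrite (@continuous_FTC2 _ f F) ?EFinB //.
  - by rewrite gtrN.
  - exact: continuous_subspaceT.
  - have cF x : {for x, continuous F}.
      by apply/differentiable_continuous/derivable1_diffP; case: (dF x).
    split => [x _||]; first by case: (dF x).
      exact/cvg_at_right_filter/cF.
    exact/cvg_at_left_filter/cF.
  - by move=> x _; rewrite derive1E; case: (dF x).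
have [|||||_ _] := @dominated_convergence _ _ _ mu setT measurableT
  (fun k => (EFin \o f) \_ `[(- k.+1%:R)%R, k.+1%:R]) (EFin \o f)
  (fun x => `|(EFin \o f) x|%E).
- move=> k; apply/measurable_restrict => //.
  by apply: measurable_funTS; exact: measurable_int fi.
- exact: measurable_int fi.
- apply: aeW => x _; apply: cvg_near_cst.
  near=> k; rewrite patchE ifT // inE /= in_itv /= -ler_norml.
  apply: le_trans (_ : k%:R <= _); last by rewrite ler_nat.
  by near: k; exact: nbhs_infty_ger.
- exact: integrable_abse.
- apply: aeW => x n _; rewrite patchE; case: ifPn => // _.
  by rewrite abse0.
have -> : (fun k => \int[mu]_x ((EFin \o f) \_ `[(- k.+1%:R)%R, k.+1%:R]) x)%E =
    (fun k => (F k.+1%:R - F (- k.+1%:R))%:E).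
  by apply/funext => k; rewrite -FTC [RHS]integral_mkcond.
have lim0 : (F k.+1%:R - F (- k.+1%:R))%:E @[k --> \oo] --> (0 : R)%:E.
  apply/fine_cvgP; split; first exact: nearW.
  rewrite -[X in _ --> X](subr0 0); apply: cvgB.
    by rewrite (cvg_shiftS (fun k => F k%:R)).
  by rewrite (cvg_shiftS (fun k => F (- k%:R))).
by move=> h; exact: (cvg_unique _ h lim0).
Unshelve. all: by end_near. Qed.

(** The recursion is integration by parts against the density, [E X^(k+2) = (k+1) E X^k]. *)
Fixpoint gauss_moment (n : nat) : R :=
  match n with
  | 0 => 1
  | 1 => 0
  | (k.+1 as k1).+1 => k1%:R * gauss_moment k
  end.

(** At [n = 0] the exponent [n.-1] is a dummy: its coefficient is 0. *)
Lemma expX_is_derive (n : nat) (x : R) :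
  is_derive x (1 : R) (fun x => x ^+ n * expR (- (x ^+ 2 / 2)))
    (n%:R * (x ^+ n.-1 * expR (- (x ^+ 2 / 2))) -
     x ^+ n.+1 * expR (- (x ^+ 2 / 2))).
Proof.
have dsq : is_derive x (1 : R) (fun x => - (x ^+ 2 / 2)) (- x).
  have d1 : is_derive x (1 : R) (fun x : R => x ^+ 2) (2 * x).
    by apply: is_derive_eq; rewrite /GRing.scale /=; ring.
  have d2 : is_derive x (1 : R) (fun x : R => x ^+ 2 / 2) x.
    have -> : (fun x : R => x ^+ 2 / 2) = (2^-1 : R) \*: (fun x : R => x ^+ 2).
      by apply/funext => z /=; rewrite mulrC.
    apply: is_derive_eq; rewrite /GRing.scale /=; lra.
  exact: is_deriveN.
have dexp : is_derive x (1 : R) (fun x => expR (- (x ^+ 2 / 2)))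
    (- x * expR (- (x ^+ 2 / 2))).
  have := @is_derive1_comp _ expR (fun x => - (x ^+ 2 / 2)) x _ _ (is_derive_expR _) dsq.
  by rewrite mulrC.
have dX : is_derive x (1 : R) (fun x => x ^+ n) (n%:R * x ^+ n.-1).
  apply: DeriveDef; first exact: exprn_derivable.
  by rewrite exp_derive /GRing.scale /= mulr1.
have := is_deriveM dX dexp; rewrite /GRing.scale /= => h.
by apply: (is_derive_eq h); rewrite (exprS x n); ring.
Qed.

Lemma continuous_expX (n : nat) :
  continuous (fun x : R => x ^+ n * expR (- (x ^+ 2 / 2))).
Proof.
move=> x; apply/differentiable_continuous/derivable1_diffP.
by case: (expX_is_derive n x).
Qed.

(** The derivative of [x^k expR (- (x^2/2))] integrates to 0, which gives the recursion, and also
    the first moment at [k = 0]. The factor [(normal_peak 1)^-1] is the total mass, known from the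
    normalized density. *)
Lemma integral_expX (n : nat) :
  (\int[mu]_x (x ^+ n * expR (- (x ^+ 2 / 2)))%:E =
   (gauss_moment n)%:E * (normal_peak 1)^-1%:E)%E.
Proof.
have peak0 : (normal_peak 1 : R) != 0 by rewrite gt_eqF // normal_peak_gt0 ?oner_eq0.
have step k : (\int[mu]_x (k%:R * (x ^+ k.-1 * expR (- (x ^+ 2 / 2))) -
     x ^+ k.+1 * expR (- (x ^+ 2 / 2)))%:E = 0)%E.
  apply: (integral_derivative_eq0 (F := fun x => x ^+ k * expR (- (x ^+ 2 / 2)))).
  - have -> : EFin \o (fun x : R => k%:R * (x ^+ k.-1 * expR (- (x ^+ 2 / 2))) -
       x ^+ k.+1 * expR (- (x ^+ 2 / 2))) =
      ((fun x : R => k%:R%:E * (x ^+ k.-1 * expR (- (x ^+ 2 / 2)))%:E) \-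
       (fun x : R => (x ^+ k.+1 * expR (- (x ^+ 2 / 2)))%:E))%E by [].
    apply: integrableB => //; last exact: integrable_expX.
    by apply: integrableZl => //; exact: integrable_expX.
  - move=> x; apply: cvgB; last exact: continuous_expX.
    by apply: cvgMr; exact: continuous_expX.
  - exact: expX_is_derive.
  - by have := cvg_expX k (expr1n _ 2); under eq_fun do rewrite mul1r.
  - have eN : (-1 : R) ^+ 2 = 1 by rewrite sqrrN expr1n.
    by have := cvg_expX k eN; under eq_fun do rewrite mulN1r.
have step2 k : (\int[mu]_x (x ^+ k.+1 * expR (- (x ^+ 2 / 2)))%:E =
    k%:R%:E * \int[mu]_x (x ^+ k.-1 * expR (- (x ^+ 2 / 2)))%:E)%E.
  have := step k.
  under eq_integral do rewrite EFinB EFinM.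
  rewrite integralB //; [|by apply: integrableZl => //; exact: integrable_expX|
    exact: integrable_expX].
  rewrite integralZl //; last exact: integrable_expX.
  have fin1 : (\int[mu]_x (x ^+ k.+1 * expR (- (x ^+ 2 / 2)))%:E)%E \is a fin_num.
    by apply: integrable_fin_num => //; exact: integrable_expX.
  have fin2 : (\int[mu]_x (x ^+ k.-1 * expR (- (x ^+ 2 / 2)))%:E)%E \is a fin_num.
    by apply: integrable_fin_num => //; exact: integrable_expX.
  rewrite -(fineK fin1) -(fineK fin2) -EFinM -EFinB => -[/eqP].
  by rewrite subr_eq0 => /eqP ->.
elim/ltn_ind: n => -[|[|n]] IH.
- have := integral_normal_pdf (0 : R) 1.
  have -> : (fun x : R => (phi x)%:E) =
      (fun x => (normal_peak 1)%:E * (x ^+ 0 * expR (- (x ^+ 2 / 2)))%:E)%E.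
    by apply/funext => x; rewrite std_normal_pdfE expr0 mul1r EFinM.
  rewrite integralZl //; last exact: integrable_expX.
  have fin1 : (\int[mu]_x (x ^+ 0 * expR (- (x ^+ 2 / 2)))%:E)%E \is a fin_num.
    by apply: integrable_fin_num => //; exact: integrable_expX.
  rewrite -(fineK fin1) -EFinM => -[h]; congr EFin.
  by rewrite /= mul1r; apply: (mulfI peak0); rewrite h mulfV.
- by rewrite step2 mul0e /= mul0e.
- by rewrite step2 IH // muleA /= EFinM.
Qed.

(** * Moments of a random variable with standard normal law *)

Section StdGaussianVariable.
Context {dT : measure_display} {T : measurableType dT} (P : probability T R).
Variable X : T -> R.
Hypothesis mX : measurable_fun setT X.
Hypothesis PX : forall B : set R, measurable B ->
  P (X @^-1` B) = normal_prob 0%R 1%R B.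

Let Xm : {mfun T >-> measurableTypeR R} :=
  HB.pack X (isMeasurableFun.Build _ _ T (measurableTypeR R) X mX).

Let integral_law (h : R -> \bar R) :
  (\int[distribution P Xm]_x h x = \int[normal_prob 0%R 1%R]_x h x)%E.
Proof. by apply: eq_measure_integral => B mB _; exact: PX. Qed.

Lemma ge0_integral_std_gaussian (h : R -> \bar R) : measurable_fun setT h ->
  (forall x, 0 <= h x)%E ->
  (\int[P]_w h (X w) = \int[normal_prob 0%R 1%R]_x h x)%E.
Proof. by move=> mh h0; rewrite -integral_law ge0_integral_distribution. Qed.

Lemma integrable_std_gaussianX (n : nat) :
  P.-integrable setT (EFin \o (fun w => X w ^+ n)).
Proof.
apply/integrableP; split.
  by apply/measurable_EFinP; exact: measurable_funX.
have mh : measurable_fun setT (fun x : R => (`|x ^+ n|)%:E).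
  by apply/measurable_EFinP; apply: measurableT_comp => //; exact: measurable_funX.
rewrite (_ : (fun x => _) = (fun w => (`|X w ^+ n|)%:E)) //.
rewrite (ge0_integral_std_gaussian mh) // integral_normal_prob_ge0 //.
have := integrableZl (mu := mu) measurableT (normal_peak 1) (integrable_expX n).
move=> /integrableP[_]; apply: le_lt_trans.
apply: ge0_le_integral => //.
- by move=> x _; rewrite mule_ge0 // lee_fin normal_pdf_ge0.
- by apply: emeasurable_funM => //; apply/measurable_EFinP; exact: measurable_normal_pdf.
- apply: measurableT_comp => //; apply: emeasurable_funM => //.
  exact: measurable_int (integrable_expX n).
- move=> x _; rewrite -!EFinM /= lee_fin std_normal_pdfE !normrM.
  rewrite (ger0_norm (normal_peak_ge0 _)) (ger0_norm (expR_ge0 _)).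
  by rewrite mulrCA.
Qed.

Lemma expectation_std_gaussianX (n : nat) :
  \int[P]_w (X w ^+ n) = gauss_moment n.
Proof.
have i1 := integrable_std_gaussianX n.
have mXn : measurable_fun setT (EFin \o (fun x : R => x ^+ n)).
  by apply/measurable_EFinP; exact: measurable_funX.
have iN : (normal_prob 0%R 1%R).-integrable setT (EFin \o (fun x : R => x ^+ n)).
  apply/integrableP; split=> //.
  rewrite -ge0_integral_std_gaussian //; first by case/integrableP: i1.
  by apply: measurableT_comp.
rewrite /Rintegral.
rewrite (_ : (\int[P]_w _)%E = \int[normal_prob 0%R 1%R]_x (x ^+ n)%:E)%E; last first.
  by rewrite -integral_law integral_distribution.
rewrite integral_normal_prob //.
rewrite (_ : (fun x : R => _) =
    (fun x : R => (normal_peak 1)%:E * (x ^+ n * expR (- (x ^+ 2 / 2)))%:E)%E); last first.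
  by apply/funext => x; rewrite -!EFinM std_normal_pdfE mulrCA.
rewrite integralZl //; last exact: integrable_expX.
rewrite integral_expX -!EFinM /= mulrC mulfVK // gt_eqF //.
by rewrite normal_peak_gt0 ?oner_eq0.
Qed.

End StdGaussianVariable.
End GaussianMoments.

(** * Independence *)

Section Independence.
Context {R : realType} {dT : measure_display} {T : measurableType dT}.
Variables (P : probability T R) (I : eqType) (X : I -> T -> R).
Hypothesis mX : forall j, measurable_fun setT (X j).
Hypothesis indep : mutually_independent P X.
Implicit Types (D : set I) (f g : T -> R).

(** A pi-system generating the sigma-algebra of the variables [X j] with [j] in [D]. *)
Definition cylinders D : set (set T) :=
  [set A | exists (s : seq I) (B : I -> set R),
    [/\ uniq s, forall j, j \in s -> D j, forall j, measurable (B j) &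
      A = \big[setI/setT]_(j <- s) (X j @^-1` B j)]].

Lemma bigsetI_preimageE (s : seq I) (B : I -> set R) :
  \big[setI/setT]_(j <- s) (X j @^-1` B j) =
  [set w | forall j, j \in s -> B j (X j w)].
Proof.
elim: s => [|i s IH]; first by rewrite big_nil; apply/seteqP.
rewrite big_cons IH; apply/seteqP; split=> w /= h.
  by move=> j; rewrite in_cons => /predU1P[->|js]; [case: h|case: h => _; apply].
by split=> [|j js]; apply: h; rewrite in_cons ?eqxx // js orbT.
Qed.

Lemma setI_closed_cylinders D : setI_closed (cylinders D).
Proof.
move=> _ _ [s1 [B1 [u1 D1 m1 ->]]] [s2 [B2 [u2 D2 m2 ->]]].
exists (undup (s1 ++ s2)).
exists (fun j => (if j \in s1 then B1 j else setT) `&`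
                 (if j \in s2 then B2 j else setT)).
split; first exact: undup_uniq.
- by move=> j; rewrite mem_undup mem_cat => /orP[/D1|/D2].
- by move=> j; apply: measurableI; case: ifP.
- rewrite !bigsetI_preimageE; apply/seteqP; split=> w /=.
    by move=> [h1 h2] j _; split; case: ifPn => // js; [exact: h1|exact: h2].
  move=> h; split=> j js; have := h j; rewrite mem_undup mem_cat js ?orbT /=.
    by case.
  by case.
Qed.

Lemma measurable_preimageX j (B : set R) : measurable B ->
  measurable (X j @^-1` B).
Proof. by move=> mB; rewrite -[_ @^-1` _]setTI; exact: mX. Qed.

Lemma sub_cylinders_measurable D : cylinders D `<=` measurable.
Proof.
move=> _ [s [B [_ _ mB ->]]]; apply: bigsetI_measurable => j _.
exact: measurable_preimageX.
Qed.

(** Uniqueness of measures: with [C] the event on [X j0], the finite measures sending [A] to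
    [P (A & C)] and to [P C * P A] agree on the cylinders, a pi-system, hence on the generated
    sigma-algebra. *)
Lemma indep_cylinders D j0 (A : set T) (B : set R) : ~ D j0 ->
  <<s cylinders D >> A -> measurable B ->
  P (A `&` X j0 @^-1` B) = (P A * P (X j0 @^-1` B))%E.
Proof.
move=> Dj0 sA mB; set C := X j0 @^-1` B.
have mC : measurable C by exact: measurable_preimageX.
have PC0 : 0 <= fine (P C) by rewrite fine_ge0.
have PCE : (fine (P C))%:E = P C by rewrite fineK // fin_num_measure.
have cT : cylinders D setT.
  by exists [::], (fun=> setT); rewrite big_nil.
rewrite muleC -PCE -[LHS]/(mrestr P mC A).
rewrite -[RHS]/(mscale (NngNum PC0) P A).
apply: (g_sigma_algebra_measure_unique (cylinders D) _ (fun=> setT)) => //.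
- exact: sub_cylinders_measurable.
- by rewrite bigcup_const.
- exact: setI_closed_cylinders.
- move=> _ [s [B' [us Ds mB' ->]]].
  rewrite -[LHS]/(P (_ `&` C)) -[RHS]/((fine (P C))%:E * P _)%E PCE.
  have js : j0 \notin s by apply/negP => /Ds.
  (* One family of sets for [j0 :: s]; as [j0] is not in [s], the cylinder over [s] is unchanged. *)
  pose B2 j := if j == j0 then B else B' j.
  have sE : \big[setI/setT]_(j <- s) (X j @^-1` B' j) =
      \big[setI/setT]_(j <- s) (X j @^-1` B2 j).
    rewrite big_seq [RHS]big_seq; apply: eq_bigr => j jins.
    by rewrite /B2; case: eqP => // jj; rewrite jj (negbTE js) in jins.
  have mB2 j : measurable (B2 j) by rewrite /B2; case: ifP.
  have CE : C = X j0 @^-1` B2 j0 by rewrite /B2 eqxx.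
  have us' : uniq (j0 :: s) by rewrite /= js.
  have := indep us' mB2; rewrite !big_cons -CE -sE setIC => ->.
  by rewrite sE indep.
- by move=> k; rewrite /mrestr /= ltey_eq fin_num_measure // measurableI.
Qed.

Definition cyl_measurable D f :=
  measurable_fun (setT : set (g_sigma_algebraType (cylinders D))) f.

Lemma cyl_measurableW D f : cyl_measurable D f -> measurable_fun setT f.
Proof.
move=> mf _ B mB; have := mf measurableT B mB; rewrite !setTI.
apply: smallest_sub; first exact: sigma_algebra_measurable.
exact: sub_cylinders_measurable.
Qed.

Lemma cyl_measurableS D D' f : D `<=` D' ->
  cyl_measurable D f -> cyl_measurable D' f.
Proof.
move=> DD mf _ B mB; have := mf measurableT B mB.
apply: smallest_sub; first exact: smallest_sigma_algebra.
move=> A [s [B' [us Ds mB' ->]]]; apply: sub_sigma_algebra.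
by exists s, B'; split=> // j /Ds; exact: DD.
Qed.

Lemma cyl_measurableX D j : D j -> cyl_measurable D (X j).
Proof.
move=> Dj _ B mB; rewrite setTI; apply: sub_sigma_algebra.
exists [:: j], (fun=> B); split=> //; last by rewrite big_seq1.
by move=> i; rewrite inE => /eqP ->.
Qed.

(* Expectations factor because the joint law of two independent variables is
   the product of their laws. *)
Lemma expectation_indepM f g : measurable_fun setT f -> measurable_fun setT g ->
  (forall A B : set R, measurable A -> measurable B ->
    P (f @^-1` A `&` g @^-1` B) = (P (f @^-1` A) * P (g @^-1` B))%E) ->
  P.-integrable setT (EFin \o f) -> P.-integrable setT (EFin \o g) ->
  P.-integrable setT (EFin \o (fun w => f w * g w)) ->
  \int[P]_w (f w * g w) = \int[P]_w f w * \int[P]_w g w.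
Proof.
move=> mf mg fg fi gi fgi.
pose fm : {mfun T >-> R} := HB.pack f (isMeasurableFun.Build _ _ T R f mf).
pose gm : {mfun T >-> R} := HB.pack g (isMeasurableFun.Build _ _ T R g mg).
have mh : measurable_fun setT (fun w => (f w, g w)) by exact: measurable_fun_pair.
pose hm : {mfun T >-> (R * R)%type} :=
  HB.pack (fun w => (f w, g w)) (isMeasurableFun.Build _ _ T (R * R)%type _ mh).
pose m1 := distribution P fm; pose m2 := distribution P gm.
pose pr (z : R * R) : \bar R := (z.1 * z.2)%:E.
have mpr : measurable_fun setT pr.
  by apply/measurable_EFinP; apply: measurable_funM;
    [exact: measurable_fst|exact: measurable_snd].
have prodE : forall Z : set (R * R), measurable Z ->
    (m1 \x m2)%E Z = distribution P hm Z.
  by apply: product_measure_unique => A B mA mB; exact: fg.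
have ipr : (m1 \x m2)%E.-integrable setT pr.
  apply/integrableP; split=> //.
  rewrite (eq_measure_integral (distribution P hm)); last by move=> Z mZ _; exact: prodE.
  rewrite ge0_integral_distribution //; first by case/integrableP: fgi.
  exact: measurableT_comp.
have E1 : (\int[P]_w (f w * g w)%:E = \int[m1 \x m2]_z pr z)%E.
  rewrite (eq_measure_integral (distribution P hm)); last by move=> Z mZ _; exact: prodE.
  by rewrite integral_distribution.
have fin_f : (\int[P]_w (f w)%:E)%E \is a fin_num by exact: integrable_fin_num.
have fin_g : (\int[P]_w (g w)%:E)%E \is a fin_num by exact: integrable_fin_num.
have ig2 : m2.-integrable setT (fun y : R => y%:E).
  apply/integrableP; split; first exact/measurable_EFinP.
  rewrite ge0_integral_distribution //; first by case/integrableP: gi.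
  by apply/measurableT_comp => //; exact/measurable_EFinP.
have if1 : m1.-integrable setT (fun y : R => y%:E).
  apply/integrableP; split; first exact/measurable_EFinP.
  rewrite ge0_integral_distribution //; first by case/integrableP: fi.
  by apply/measurableT_comp => //; exact/measurable_EFinP.
have g2 : (\int[m2]_y y%:E = \int[P]_w (g w)%:E)%E.
  by rewrite integral_distribution //; exact/measurable_EFinP.
have f1 : (\int[m1]_y y%:E = \int[P]_w (f w)%:E)%E.
  by rewrite integral_distribution //; exact/measurable_EFinP.
rewrite /Rintegral E1 -integral12_prod_meas1 //.
rewrite (_ : fubini_F m2 pr = (fun x => x%:E * (fine (\int[P]_w (g w)%:E))%:E)%E); last first.
  apply/funext => x; rewrite /fubini_F /pr /=.
  under eq_integral do rewrite EFinM.
  by rewrite integralZl // g2 fineK.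
by rewrite integralZr // f1 fineM // fineK.
Qed.

(** Unlike integrability, this property is stable under products, so every polynomial in the noise
    is integrable without further estimates. *)
Definition all_moments f :=
  forall n, P.-integrable setT (EFin \o (fun w => f w ^+ n)).

Lemma all_moments_integrable f : all_moments f -> P.-integrable setT (EFin \o f).
Proof. by move=> /(_ 1%N); under eq_fun do rewrite expr1. Qed.

Lemma all_moments_cst c : all_moments (fun=> c).
Proof.
by move=> n; apply: finite_measure_integrable_cst.
Qed.

Lemma all_momentsM f g : measurable_fun setT f -> measurable_fun setT g ->
  all_moments f -> all_moments g -> all_moments (fun w => f w * g w).
Proof.
move=> mf mg If Ig n.
have Ifg := integrableD measurableT (If n.*2) (Ig n.*2).
apply: le_integrable Ifg => //.
  by apply/measurable_EFinP; apply: measurable_funX; exact: measurable_funM.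
move=> w _ /=; rewrite lee_fin exprMn normrM -muln2 !exprM.
rewrite [leRHS]ger0_norm ?addr_ge0 ?sqr_ge0 //.
rewrite -(real_normK (num_real (f w ^+ n))) -(real_normK (num_real (g w ^+ n))).
set x := `|_|; set y := `|_|.
have := sqr_ge0 (x - y); have x0 : 0 <= x * y by rewrite mulr_ge0 ?normr_ge0.
rewrite sqrrB; lra.
Qed.

Lemma all_momentsD f g : measurable_fun setT f -> measurable_fun setT g ->
  all_moments f -> all_moments g -> all_moments (fun w => f w + g w).
Proof.
move=> mf mg If Ig n.
have If' := integrable_abse (If n); have Ig' := integrable_abse (Ig n).
have Ifg := integrableZl measurableT (2 ^+ n) (integrableD measurableT If' Ig').
apply: le_integrable Ifg => //.
  by apply/measurable_EFinP; apply: measurable_funX; exact: measurable_funD.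
move=> w _ /=; rewrite lee_fin [leRHS]ger0_norm ?mulr_ge0 ?addr_ge0 ?exprn_ge0 //.
rewrite !normrX; set x := `|f w|; set y := `|g w|.
have x0 : 0 <= x by exact: normr_ge0.
have y0 : 0 <= y by exact: normr_ge0.
have xy : `|f w + g w| <= x + y by exact: ler_normD.
apply: le_trans (lerXn2r n _ _ xy) _; rewrite ?nnegrE ?addr_ge0 //.
wlog xley : x y x0 y0 {xy} / x <= y.
  move=> H; case: (leP x y) => [|/ltW] xley; first exact: H.
  by have := H y x y0 x0 xley; rewrite (addrC y) (addrC (y ^+ n)).
apply: le_trans (_ : (2 * y) ^+ n <= _).
  by apply: lerXn2r; rewrite ?nnegrE ?addr_ge0 ?mulr_ge0 //; lra.
by rewrite exprMn ler_wpM2l ?exprn_ge0 // lerDr exprn_ge0.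
Qed.

Definition regular D f := cyl_measurable D f /\ all_moments f.

Lemma regular_cst D c : regular D (fun=> c).
Proof. by split; [exact: measurable_cst|exact: all_moments_cst]. Qed.

Lemma regularM D f g : regular D f -> regular D g ->
  regular D (fun w => f w * g w).
Proof.
move=> [mf If] [mg Ig]; split; first exact: measurable_funM.
by apply: all_momentsM => //; [exact: cyl_measurableW mf|exact: cyl_measurableW mg].
Qed.

Lemma regularD D f g : regular D f -> regular D g ->
  regular D (fun w => f w + g w).
Proof.
move=> [mf If] [mg Ig]; split; first exact: measurable_funD.
by apply: all_momentsD => //; [exact: cyl_measurableW mf|exact: cyl_measurableW mg].
Qed.

Lemma regularZ D c f : regular D f -> regular D (fun w => c * f w).
Proof. by apply: regularM; exact: regular_cst. Qed.

Lemma regularB D f g : regular D f -> regular D g ->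
  regular D (fun w => f w - g w).
Proof.
move=> rf rg; apply: regularD => //.
by have := regularZ (-1) rg; under eq_fun do rewrite mulN1r.
Qed.

Lemma regular_sum D (J : Type) (r : seq J) (F : J -> T -> R) :
  (forall j, regular D (F j)) -> regular D (fun w => \sum_(j <- r) F j w).
Proof.
move=> rF; elim: r => [|j r IH].
  by under eq_fun do rewrite big_nil; exact: regular_cst.
by under eq_fun do rewrite big_cons; exact: regularD.
Qed.

Lemma regularX D n f : regular D f -> regular D (fun w => f w ^+ n).
Proof.
move=> rf; elim: n => [|n IH].
  by under eq_fun do rewrite expr0; exact: regular_cst.
by under eq_fun do rewrite exprS; exact: regularM.
Qed.

Lemma regularS D D' f : D `<=` D' -> regular D f -> regular D' f.
Proof. by move=> DD [mf If]; split=> //; exact: cyl_measurableS DD mf. Qed.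

Lemma regular_integrable D f : regular D f -> P.-integrable setT (EFin \o f).
Proof. by move=> [_ /all_moments_integrable]. Qed.

Hypothesis gaussX : forall j (B : set R), measurable B ->
  P (X j @^-1` B) = normal_prob 0%R 1%R B.

Lemma regular_gauss D j : D j -> regular D (X j).
Proof.
move=> Dj; split; first exact: cyl_measurableX.
by move=> n; apply: integrable_std_gaussianX => //; exact: gaussX.
Qed.

Lemma expectation_mul_gaussX D j n f : ~ D j -> regular D f ->
  \int[P]_w (f w * X j w ^+ n) = \int[P]_w f w * gauss_moment R n.
Proof.
move=> Dj rf.
have mXn : measurable_fun setT (fun w => X j w ^+ n) by exact: measurable_funX.
rewrite -(expectation_std_gaussianX (mX j) (gaussX j) n).
apply: expectation_indepM => //.
- by case: rf => /cyl_measurableW.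
- move=> A B mA mB.
  have -> : (fun w => X j w ^+ n) @^-1` B = X j @^-1` ((fun x : R => x ^+ n) @^-1` B) by [].
  apply: (indep_cylinders Dj).
    by case: rf => /(_ measurableT _ mA); rewrite setTI.
  have mp : measurable_fun setT (fun x : R => x ^+ n) by exact: measurable_funX.
  by have := mp measurableT _ mB; rewrite setTI.
- exact: regular_integrable rf.
- by apply: integrable_std_gaussianX => //; exact: gaussX.
- apply: (@regular_integrable (D `|` [set j])); apply: regularM.
    by apply: regularS rf; exact: subsetUl.
  by apply/regularX/regular_gauss; right.
Qed.

End Independence.

(** * Wick's formula in a rotated frame *)

Section Wick.
Context {R : realType} {dT : measure_display} {T : measurableType dT}.
Variables (P : probability T R) (d : nat) (u : nat -> T -> 'cV[R]_d).
Hypothesis hu : iid_std_gaussian P u.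

Definition noise_coord (ti : nat * 'I_d) (w : T) : R := u ti.1 w ti.2 ord0.

Let mX ti : measurable_fun setT (noise_coord ti).
Proof. by have [h _] := hu; exact: h. Qed.

Let indep : mutually_independent P noise_coord.
Proof. by have [_ [_ h]] := hu; exact: h. Qed.

Let gaussX ti (B : set R) : measurable B ->
  P (noise_coord ti @^-1` B) = normal_prob 0%R 1%R B.
Proof. by have [_ [h _]] := hu; exact: h. Qed.

(** The inequality is strict because iterate [t] depends on the noise before time [t] only; the
    noise at time [t] is independent of it. *)
Definition past (t : nat) : set (nat * 'I_d) := [set ti | (ti.1 < t)%N].

Definition adapted t (f : T -> R) := regular P noise_coord (past t) f.

Lemma adapted_int t f : adapted t f -> P.-integrable setT (EFin \o f).
Proof. exact: regular_integrable. Qed.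

Lemma adaptedS t f : adapted t f -> adapted t.+1 f.
Proof. by apply: regularS => ti /= h; exact: ltnW. Qed.

Lemma adapted_cst t c : adapted t (fun=> c).
Proof. exact: regular_cst. Qed.

Lemma adaptedM t f g : adapted t f -> adapted t g -> adapted t (fun w => f w * g w).
Proof. exact: regularM. Qed.

Lemma adaptedD t f g : adapted t f -> adapted t g -> adapted t (fun w => f w + g w).
Proof. exact: regularD. Qed.

Lemma adaptedB t f g : adapted t f -> adapted t g -> adapted t (fun w => f w - g w).
Proof. exact: regularB. Qed.

Lemma adaptedZ t c f : adapted t f -> adapted t (fun w => c * f w).
Proof. exact: regularZ. Qed.

Lemma adapted_sum t (J : Type) (r : seq J) (F : J -> T -> R) :
  (forall j, adapted t (F j)) -> adapted t (fun w => \sum_(j <- r) F j w).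
Proof. exact: regular_sum. Qed.

Lemma adapted_noise_coord t i : adapted t.+1 (noise_coord (t, i)).
Proof. by apply: regular_gauss => //; exact: ltnSn. Qed.

Lemma Ex_cst (c : R) : \int[P]_w c = c.
Proof.
have := expectation_cst P c; rewrite unlock => h.
by rewrite -[LHS]/(fine (\int[P]_w (cst c w)%:E)%E) h.
Qed.

Lemma ExZ t c f : adapted t f -> \int[P]_w (c * f w) = c * \int[P]_w f w.
Proof. by move=> /adapted_int fi; rewrite RintegralZl. Qed.

Lemma ExD t f g : adapted t f -> adapted t g ->
  \int[P]_w (f w + g w) = \int[P]_w f w + \int[P]_w g w.
Proof. by move=> /adapted_int fi /adapted_int gi; rewrite RintegralD. Qed.

Lemma ExB t f g : adapted t f -> adapted t g ->
  \int[P]_w (f w - g w) = \int[P]_w f w - \int[P]_w g w.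
Proof. by move=> /adapted_int fi /adapted_int gi; rewrite RintegralB. Qed.

Lemma Ex_sum t (J : Type) (r : seq J) (F : J -> T -> R) :
  (forall j, adapted t (F j)) ->
  \int[P]_w (\sum_(j <- r) F j w) = \sum_(j <- r) \int[P]_w F j w.
Proof.
move=> rF; elim: r => [|j r IH].
  rewrite big_nil (@eq_Rintegral _ _ _ _ _ (fun=> 0)) ?Ex_cst // => w _.
  by rewrite big_nil.
rewrite big_cons -IH -(ExD (rF j) (adapted_sum r rF)).
by apply: eq_Rintegral => w _; rewrite big_cons.
Qed.

(** Regularity and value go together: splitting off coordinate [i] uses its independence from the
    past and from the other factors, so the partial product must be known to depend on these
    alone. *)
Lemma Ex_prod_gauss t (e : 'I_d -> nat) f (r : seq 'I_d) :
  uniq r -> adapted t f ->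
  regular P noise_coord (past t `|` [set ti | ti.1 = t /\ ti.2 \in r])
    (fun w => f w * \prod_(i <- r) noise_coord (t, i) w ^+ e i) /\
  \int[P]_w (f w * \prod_(i <- r) noise_coord (t, i) w ^+ e i) =
  \int[P]_w f w * \prod_(i <- r) gauss_moment R (e i).
Proof.
move=> + af; elim: r => [_|i r IH] /=.
  split; last first.
    rewrite big_nil mulr1; apply: eq_Rintegral => w _.
    by rewrite big_nil mulr1.
  have -> : (fun w => f w * \prod_(i <- [::]) noise_coord (t, i) w ^+ e i) = f.
    by apply/funext => w; rewrite big_nil mulr1.
  by apply: regularS af; exact: subsetUl.
move=> /andP[ir ur]; have [reg Exr] := IH ur.
have shape w : f w * \prod_(j <- i :: r) noise_coord (t, j) w ^+ e j =
    (f w * \prod_(j <- r) noise_coord (t, j) w ^+ e j) * noise_coord (t, i) w ^+ e i.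
  by rewrite big_cons mulrCA mulrC.
split.
  rewrite (funext shape).
  apply: (regularM mX).
    apply: regularS reg => ti [h|[h1 h2]]; first by left.
    by right; rewrite /= in_cons h2 orbT.
  by apply: (regularX mX); apply: regular_gauss => //=; right; rewrite /= mem_head.
under eq_Rintegral do rewrite shape.
rewrite (expectation_mul_gaussX mX indep gaussX _ _ reg); last first.
  by move=> [|[_]] /=; [rewrite /past /= ltnn | exact/negP].
by rewrite Exr big_cons mulrCA mulrC.
Qed.

Lemma prod_expr_delta (x : 'I_d -> R) i : \prod_j x j ^+ (j == i) = x i.
Proof.
rewrite (bigD1 i) //= eqxx expr1 big1 ?mulr1 // => j /negbTE ->.
by rewrite expr0.
Qed.

Lemma gauss_moment_eq0 (e : 'I_d -> nat) i : e i = 1%N \/ e i = 3%N ->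
  \prod_j gauss_moment R (e j) = 0.
Proof. by move=> [] ei; rewrite (bigD1 i) //= ei /= ?mulr0 mul0r. Qed.

Lemma Ex_gauss2 t f i j : adapted t f ->
  \int[P]_w (f w * (noise_coord (t, i) w * noise_coord (t, j) w)) =
  (i == j)%:R * \int[P]_w f w.
Proof.
move=> af.
(* The exponent counts the occurrences of [x] among [i] and [j]. *)
have [_] := Ex_prod_gauss (fun x => (x == i) + (x == j))%N (index_enum_uniq _) af.
under eq_Rintegral do under eq_bigr do rewrite exprD.
under eq_Rintegral do rewrite big_split /= !prod_expr_delta.
move=> ->; rewrite mulrC; congr (_ * _).
have [<-|ij] := eqVneq i j.
  rewrite big1 // => x _; case: eqP => _ //=.
  by rewrite mulr1.
by apply: (@gauss_moment_eq0 _ i); left; rewrite eqxx (negbTE ij).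
Qed.

Definition wick (i j k l : 'I_d) : R :=
  (i == j)%:R * (k == l)%:R + (i == k)%:R * (j == l)%:R + (i == l)%:R * (j == k)%:R.

(** An index of odd multiplicity kills both sides, two distinct pairs match a single pairing, and
    four equal indices give the fourth moment 3, one unit per pairing. *)
Lemma prod_gauss_moment4 i j k l :
  \prod_x gauss_moment R ((x == i) + (x == j) + (x == k) + (x == l)) =
  wick i j k l.
Proof.
pose e x := ((x == i) + (x == j) + (x == k) + (x == l))%N.
rewrite -[LHS]/(\prod_x gauss_moment R (e x)) /wick.
have pair p q : p != q -> (forall x, e x = ((x == p) + (x == q)).*2) ->
    \prod_x gauss_moment R (e x) = 1.
  move=> pq eE; rewrite big1 // => x _; rewrite eE.
  have [->|_] := eqVneq x p; first by rewrite (negbTE pq) /= !mulr1.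
  by case: eqP => _ //=; rewrite !mulr1.
have [ij|ij] := eqVneq i j; last first.
  have [ik|ik] := eqVneq i k; last first.
    have [il|il] := eqVneq i l; last first.
      rewrite !mul0r !addr0; apply: (@gauss_moment_eq0 _ i); left.
      by rewrite /e eqxx (negbTE ij) (negbTE ik) (negbTE il).
    have [jk|jk] := eqVneq j k.
      rewrite mulr1 mul0r mul0r !add0r; apply: (pair _ _ ij) => x.
      by rewrite /e -il -jk -addnn; case: (x == i); case: (x == j).
    rewrite mulr0 !mul0r !addr0; apply: (@gauss_moment_eq0 _ j); left.
    rewrite /e eqxx (negbTE jk) (eq_sym j i) (negbTE ij) -il eq_sym (negbTE ij).
    by [].
  have [jl|jl] := eqVneq j l.
    rewrite -ik (eq_sym j i) (negbTE ij) !mulr0 !mul0r mulr1 add0r addr0.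
    apply: (pair _ _ ij) => x.
    by rewrite /e -ik -jl -addnn; case: (x == i); case: (x == j).
  rewrite -ik (eq_sym j i) (negbTE ij) !mulr0 !mul0r !addr0.
  apply: (@gauss_moment_eq0 _ j); left.
  by rewrite /e eqxx (negbTE jl) -ik (eq_sym j i) (negbTE ij).
rewrite -{}ij in e pair *; have [ik|ik] := eqVneq i k; last first.
  have [kl|kl] := eqVneq k l.
    rewrite -kl (negbTE ik) !mul0r !addr0 mulr1; apply: (pair _ _ ik) => x.
    by rewrite /e -kl -addnn; case: (x == i); case: (x == k).
  rewrite !mulr0 !mul0r !addr0; apply: (@gauss_moment_eq0 _ k); left.
  by rewrite /e eqxx (negbTE kl) eq_sym (negbTE ik).
rewrite -{}ik in e pair *; have [il|il] := eqVneq i l; last first.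
  rewrite !mulr0 !mul0r !addr0; apply: (@gauss_moment_eq0 _ l); left.
  by rewrite /e eqxx eq_sym (negbTE il).
rewrite -{}il in e pair *; rewrite (bigD1 i) //= big1 => [|x /negbTE xi].
  by rewrite /e !eqxx /= !mulr1; ring.
by rewrite /e xi.
Qed.

Lemma Ex_gauss4 t f i j k l : adapted t f ->
  \int[P]_w (f w * (noise_coord (t, i) w * noise_coord (t, j) w * noise_coord (t, k) w *
    noise_coord (t, l) w)) =
  wick i j k l * \int[P]_w f w.
Proof.
move=> af.
have [_] := Ex_prod_gauss (fun x => (x == i) + (x == j) + (x == k) + (x == l))%N
  (index_enum_uniq _) af.
under eq_Rintegral do under eq_bigr do rewrite !exprD.
under eq_Rintegral do rewrite !big_split /= !prod_expr_delta.
by move=> ->; rewrite mulrC prod_gauss_moment4.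
Qed.

Variable Q : 'M[R]_d.
Hypothesis QQ : Q^T *m Q = 1%:M.

Let Qdelta i j : \sum_a Q a i * Q a j = (i == j)%:R.
Proof.
move/matrixP: QQ => /(_ i j); rewrite !mxE => <-.
by apply: eq_bigr => a _; rewrite mxE.
Qed.

Definition rot (v : nat -> T -> 'cV[R]_d) (t : nat) (i : 'I_d) (w : T) : R :=
  \sum_a Q a i * v t w a ord0.

Lemma adapted_rot t i : adapted t.+1 (rot u t i).
Proof. by apply: adapted_sum => a; apply/adaptedZ/adapted_noise_coord. Qed.

Lemma Ex_mul_rot t F i : adapted t.+1 F ->
  \int[P]_w (F w * rot u t i w) =
  \sum_a Q a i * \int[P]_w (F w * noise_coord (t, a) w).
Proof.
move=> aF.
rewrite (@eq_Rintegral _ _ _ _ _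
  (fun w => \sum_a Q a i * (F w * noise_coord (t, a) w))); last first.
  by move=> w _; rewrite /rot mulr_sumr; apply: eq_bigr => a _; rewrite mulrCA.
rewrite (@Ex_sum t.+1) => [|a]; last exact/adaptedZ/adaptedM/adapted_noise_coord.
apply: eq_bigr => a _; apply: (@ExZ t.+1).
exact/adaptedM/adapted_noise_coord.
Qed.

Let sum_delta (F : 'I_d -> R) (c : 'I_d) : \sum_a F a * (c == a)%:R = F c.
Proof.
rewrite (bigD1 c) //= eqxx mulr1 big1 ?addr0 // => a.
by rewrite eq_sym => /negbTE ->; rewrite mulr0.
Qed.

Lemma Ex_rot2 t f i j : adapted t f ->
  \int[P]_w (f w * (rot u t i w * rot u t j w)) = (i == j)%:R * \int[P]_w f w.
Proof.
move=> af; have af1 := adaptedS af.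
have ac a := adapted_noise_coord t a; have ar a := adapted_rot t a.
under eq_Rintegral do rewrite mulrA.
rewrite Ex_mul_rot; last exact: adaptedM.
rewrite -[in RHS]Qdelta mulr_suml; apply: eq_bigr => b _.
rewrite -mulrA mulrCA; congr (_ * _).
under eq_Rintegral do rewrite mulrAC.
rewrite Ex_mul_rot; last exact: adaptedM.
rewrite -[Q b i](sum_delta (fun a => Q a i)) mulr_suml; apply: eq_bigr => a _.
by under eq_Rintegral do rewrite -mulrA; rewrite Ex_gauss2 // mulrA.
Qed.

(** One rotated factor is expanded at a time: [E1], [E2], [E3] still contain three, two and one
    unrotated coordinates. Each sum contracts through a Kronecker delta or the orthonormality of the
    columns of [Q]. *)
Lemma Ex_rot4 t f i j k l : adapted t f ->
  \int[P]_w (f w * (rot u t i w * rot u t j w * rot u t k w * rot u t l w)) =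
  wick i j k l * \int[P]_w f w.
Proof.
move=> af; have af1 := adaptedS af.
have ac a := adapted_noise_coord t a; have ar a := adapted_rot t a.
set m := \int[P]_w f w.
have E1 a b c : \int[P]_w (f w * (noise_coord (t, a) w * noise_coord (t, b) w * noise_coord (t, c) w)
      * rot u t l w) =
    ((a == b)%:R * Q c l + (a == c)%:R * Q b l + Q a l * (b == c)%:R) * m.
  rewrite Ex_mul_rot; last by do !apply: adaptedM => //.
  under eq_bigr do under eq_Rintegral do rewrite -mulrA.
  under eq_bigr do rewrite Ex_gauss4 // mulrA.
  rewrite -mulr_suml /wick; congr (_ * _).
  rewrite (eq_bigr (fun e => (a == b)%:R * (Q e l * (c == e)%:R) +
      (a == c)%:R * (Q e l * (b == e)%:R) + (b == c)%:R * (Q e l * (a == e)%:R))).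
    2: by move=> e _; ring.
  by rewrite !big_split /= -!mulr_sumr !sum_delta; ring.
have E2 a b : \int[P]_w (f w * (noise_coord (t, a) w * noise_coord (t, b) w * rot u t k w)
      * rot u t l w) =
    ((a == b)%:R * (k == l)%:R + Q a k * Q b l + Q a l * Q b k) * m.
  rewrite (@eq_Rintegral _ _ _ _ _
    (fun w => (f w * (noise_coord (t, a) w * noise_coord (t, b) w * rot u t l w)) * rot u t k w)).
    2: by move=> w _; ring.
  rewrite Ex_mul_rot; last by do !apply: adaptedM => //.
  under eq_bigr => c _.
    rewrite (@eq_Rintegral _ _ _ _ _
      (fun w => (f w * (noise_coord (t, a) w * noise_coord (t, b) w * noise_coord (t, c) w)) * rot u t l w)).
      2: by move=> w _; ring.
    rewrite E1 mulrA; over.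
  rewrite -mulr_suml; congr (_ * _).
  rewrite (eq_bigr (fun c => (a == b)%:R * (Q c k * Q c l) +
      Q b l * (Q c k * (a == c)%:R) + Q a l * (Q c k * (b == c)%:R))).
    2: by move=> c _; ring.
  by rewrite !big_split /= -!mulr_sumr Qdelta !sum_delta; ring.
have E3 a : \int[P]_w (f w * (noise_coord (t, a) w * rot u t j w * rot u t k w)
      * rot u t l w) =
    (Q a j * (k == l)%:R + Q a k * (j == l)%:R + Q a l * (j == k)%:R) * m.
  rewrite (@eq_Rintegral _ _ _ _ _
    (fun w => (f w * (noise_coord (t, a) w * rot u t k w * rot u t l w)) * rot u t j w)).
    2: by move=> w _; ring.
  rewrite Ex_mul_rot; last by do !apply: adaptedM => //.
  under eq_bigr => c _.
    rewrite (@eq_Rintegral _ _ _ _ _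
      (fun w => (f w * (noise_coord (t, a) w * noise_coord (t, c) w * rot u t k w)) * rot u t l w)).
      2: by move=> w _; ring.
    rewrite E2 mulrA; over.
  rewrite -mulr_suml; congr (_ * _).
  rewrite (eq_bigr (fun c => (k == l)%:R * (Q c j * (a == c)%:R) +
      Q a k * (Q c j * Q c l) + Q a l * (Q c j * Q c k))).
    2: by move=> c _; ring.
  by rewrite !big_split /= -!mulr_sumr !Qdelta !sum_delta; ring.
rewrite (@eq_Rintegral _ _ _ _ _
    (fun w => (f w * (rot u t j w * rot u t k w * rot u t l w)) * rot u t i w)).
  2: by move=> w _; ring.
rewrite Ex_mul_rot; last by do !apply: adaptedM => //.
under eq_bigr => c _.
  rewrite (@eq_Rintegral _ _ _ _ _
      (fun w => (f w * (noise_coord (t, c) w * rot u t j w * rot u t k w)) * rot u t l w)).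
    2: by move=> w _; ring.
  rewrite E3 mulrA; over.
rewrite -mulr_suml; congr (_ * _).
rewrite (eq_bigr (fun c => (k == l)%:R * (Q c i * Q c j) +
      (j == l)%:R * (Q c i * Q c k) + (j == k)%:R * (Q c i * Q c l))).
  2: by move=> c _; ring.
by rewrite !big_split /= -!mulr_sumr !Qdelta /wick; ring.
Qed.

End Wick.

(** * Moment recursions *)

(** The central difference cancels every term even in [mu], so on a quadratic it is the exact
    directional derivative, whatever [mu] is. *)
Lemma zo_grad_fquad (R : realType) d (H : 'M[R]_d) c mu (xs x v : 'cV[R]_d) :
  H^T = H -> mu != 0 ->
  zo_grad (fquad c xs H) mu x v = (v^T *m H *m (x - xs)) 0 0 *: v.
Proof.
move=> Ht mu0; rewrite /zo_grad; congr (_ *: _); rewrite /fquad.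
set y := x - xs.
have -> : x + mu *: v - xs = y + mu *: v by rewrite addrAC.
have -> : x - mu *: v - xs = y - mu *: v by rewrite addrAC.
move: y => y {x xs}.
have sym : (y^T *m H *m v) 0 0 = (v^T *m H *m y) 0 0.
  rewrite -[y^T *m H *m v]trmxK mxE; congr (_ 0 0).
  by rewrite !trmx_mul trmxK Ht mulmxA.
have quad s : ((y + s *: v)^T *m H *m (y + s *: v)) 0 0 =
    (y^T *m H *m y) 0 0 + 2 * s * (v^T *m H *m y) 0 0 +
    s ^+ 2 * (v^T *m H *m v) 0 0.
  have -> : (y + s *: v)^T = y^T + s *: v^T by apply/matrixP => i j; rewrite !mxE.
  rewrite !mulmxDl !mulmxDr -!scalemxAl -!scalemxAr !scalerA.
  have DE (A B : 'M[R]_1) : (A + B) 0 0 = A 0 0 + B 0 0 by rewrite mxE.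
  have ZE (k : R) (A : 'M[R]_1) : (k *: A) 0 0 = k * A 0 0 by rewrite mxE.
  by rewrite !DE !ZE sym; ring.
rewrite -scaleNr !quad; field.
by rewrite mu0.
Qed.

Section Dynamics.
Context {R : realType} {dT : measure_display} {T : measurableType dT}.
Variables (P : probability T R) (d : nat) (u : nat -> T -> 'cV[R]_d).
Hypothesis hu : iid_std_gaussian P u.
Variables (H Q : 'M[R]_d) (lam : 'I_d -> R).
Hypothesis Ht : H^T = H.
Hypothesis QQ : Q^T *m Q = 1%:M.
Hypothesis QH : Q^T *m H *m Q = diag_mx (\row_i lam i).
Variables (c beta mu eta : R) (xs x0 : 'cV[R]_d).
Hypothesis mu0 : mu != 0.

Definition zo_error t (w : T) : 'cV[R]_d :=
  iterate (fquad c xs H) mu beta eta x0 u t w - xs.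

Definition zo_momentum t (w : T) : 'cV[R]_d :=
  (zo_gdm (fquad c xs H) mu beta eta x0 u t w).1.

Local Notation y := (rot Q zo_error).
Local Notation m := (rot Q zo_momentum).
Local Notation v := (rot Q u).

Let S t w := \sum_j lam j * (v t j w * y t j w).

Lemma rotE (z : nat -> T -> 'cV[R]_d) t i w : rot Q z t i w = (Q^T *m z t w) i 0.
Proof. by rewrite mxE; apply: eq_bigr => a _; rewrite mxE. Qed.

Lemma rot_quadE t w : (((u t w)^T *m H *m zo_error t w) 0 0 = S t w).
Proof.
have QQ' : Q *m Q^T = 1%:M by exact: mulmx1C.
have -> : H = Q *m diag_mx (\row_i lam i) *m Q^T.
  by rewrite -QH !mulmxA QQ' mul1mx -mulmxA QQ' mulmx1.
have -> : (u t w)^T *m (Q *m diag_mx (\row_i lam i) *m Q^T) *m zo_error t w =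
    (Q^T *m u t w)^T *m diag_mx (\row_i lam i) *m (Q^T *m zo_error t w).
  by rewrite trmx_mul trmxK !mulmxA.
rewrite mxE; apply: eq_bigr => j _.
by rewrite mul_mx_diag !rotE [(\matrix_(_, _) _) _ _]mxE [_^T _ _]mxE [(\row__ _) _ _]mxE; ring.
Qed.

Lemma rot_step t i w :
  m t.+1 i w = beta * m t i w + S t w * v t i w /\
  y t.+1 i w = y t i w - eta * m t.+1 i w.
Proof.
have mE : zo_momentum t.+1 w = beta *: zo_momentum t w + S t w *: u t w.
  rewrite -rot_quadE /zo_momentum /zo_error /iterate /=.
  by case: (zo_gdm _ _ _ _ _ _ t w) => m' x' /=; rewrite zo_grad_fquad.
have yE : zo_error t.+1 w = zo_error t w - eta *: zo_momentum t.+1 w.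
  rewrite /zo_momentum /zo_error /iterate /=.
  by case: (zo_gdm _ _ _ _ _ _ t w) => m' x' /=; rewrite addrAC.
split; first by rewrite !rotE mE mulmxDr -!scalemxAr !mxE.
by rewrite !rotE yE mulmxBr -scalemxAr !mxE.
Qed.

Lemma adapted_state t : (forall i, adapted P u t (m t i)) /\
  (forall i, adapted P u t (y t i)).
Proof.
elim: t => [|t [IHm IHy]].
  split=> i.
    have -> : m 0 i = (fun=> 0).
      by apply/funext => w; rewrite rotE /zo_momentum /= mulmx0 mxE.
    exact: adapted_cst.
  have -> : y 0 i = (fun=> (Q^T *m (x0 - xs)) i 0).
    by apply/funext => w; rewrite rotE.
  exact: adapted_cst.
have am i : adapted P u t.+1 (m t.+1 i).
  have -> : m t.+1 i = (fun w => beta * m t i w + S t w * v t i w).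
    by apply/funext => w; case: (rot_step t i w).
  apply: (adaptedD hu); first by apply/(adaptedZ hu)/(@adaptedS _ _ _ P _ u).
  apply: (adaptedM hu); last exact: adapted_rot.
  apply: (adapted_sum hu) => j; apply: (adaptedZ hu); apply: (adaptedM hu).
    exact: adapted_rot.
  exact: adaptedS.
split=> // i.
have -> : y t.+1 i = (fun w => y t i w - eta * m t.+1 i w).
  by apply/funext => w; case: (rot_step t i w).
apply: (adaptedB hu); first exact: adaptedS.
exact: adaptedZ.
Qed.

Let am t i : adapted P u t (m t i) := (adapted_state t).1 i.
Let ay t i : adapted P u t (y t i) := (adapted_state t).2 i.

Definition mom_yy t i : R := \int[P]_w (y t i w ^+ 2).
Definition mom_ym t i : R := \int[P]_w (y t i w * m t i w).
Definition mom_mm t i : R := \int[P]_w (m t i w ^+ 2).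
Definition mean_y t i : R := \int[P]_w y t i w.
Definition mean_m t i : R := \int[P]_w m t i w.

Let av t i : adapted P u t.+1 (v t i) := adapted_rot hu Q t i.
Let am1 t i : adapted P u t.+1 (m t i) := adaptedS (am t i).
Let ay1 t i : adapted P u t.+1 (y t i) := adaptedS (ay t i).

Let aS t : adapted P u t.+1 (S t).
Proof.
apply: (adapted_sum hu) => j; apply: (adaptedZ hu); exact: (adaptedM hu).
Qed.

Let sum_delta (F : 'I_d -> R) (k : 'I_d) : \sum_j (j == k)%:R * F j = F k.
Proof.
by rewrite (bigD1 k) //= eqxx mul1r big1 ?addr0 // => j /negbTE ->; rewrite mul0r.
Qed.

(** Unbiasedness of the estimator: given the past, [v_j v_i] averages to a Kronecker delta. *)
Lemma Ex_noise1 t i f : adapted P u t f ->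
  \int[P]_w (f w * (S t w * v t i w)) = lam i * \int[P]_w (f w * y t i w).
Proof.
move=> af.
rewrite (@eq_Rintegral _ _ _ _ _
  (fun w => \sum_j lam j * ((f w * y t j w) * (v t j w * v t i w)))); last first.
  move=> w _; rewrite /S mulr_suml mulr_sumr; apply: eq_bigr => j _; ring.
have af1 := adaptedS af.
have afy j : adapted P u t.+1 (fun w => f w * y t j w * (v t j w * v t i w)).
  by do !apply: (adaptedM hu).
rewrite (@Ex_sum _ _ _ P _ u hu t.+1) => [|j]; last exact: adaptedZ.
rewrite -(sum_delta (fun j => lam j * \int[P]_w (f w * y t j w)) i).
apply: eq_bigr => j _; rewrite (ExZ _ (afy j)).
have E := Ex_rot2 hu QQ j i (adaptedM hu af (ay t j)).
by rewrite E mulrCA.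
Qed.

(** The pairing [(j k)(i i)] yields the sum, the other two pairings one [lam i ^+ 2] term each.
    Mixed moments [E y_j y_k] with distinct indices drop out, which is why the diagonal moments
    close. *)
Lemma Ex_noise2 t i :
  \int[P]_w ((S t w * v t i w) ^+ 2) =
  \sum_j lam j ^+ 2 * mom_yy t j + 2 * (lam i ^+ 2 * mom_yy t i).
Proof.
rewrite (@eq_Rintegral _ _ _ _ _ (fun w => \sum_j \sum_k (lam j * lam k) *
  ((y t j w * y t k w) * (v t j w * v t k w * v t i w * v t i w)))); last first.
  move=> w _; rewrite exprMn expr2 {1}/S mulr_suml mulr_suml.
  apply: eq_bigr => j _; rewrite /S mulr_sumr mulr_suml.
  by apply: eq_bigr => k _; ring.
have ayy j k : adapted P u t (fun w => y t j w * y t k w) by exact: adaptedM.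
have aa j k : adapted P u t.+1 (fun w => (y t j w * y t k w) *
    (v t j w * v t k w * v t i w * v t i w)).
  by do !apply: (adaptedM hu).
rewrite (@Ex_sum _ _ _ P _ u hu t.+1) => [|j]; last first.
  by apply: (adapted_sum hu) => k; exact: adaptedZ.
pose G j k := (lam j * lam k) * \int[P]_w (y t j w * y t k w).
have Gd j : G j j = lam j ^+ 2 * mom_yy t j.
  by rewrite /G -expr2 /mom_yy; congr (_ * _); apply: eq_Rintegral => w _; rewrite expr2.
rewrite (eq_bigr (fun j => G j j + 2 * ((j == i)%:R * G j i))); last first.
  move=> j _; rewrite (@Ex_sum _ _ _ P _ u hu t.+1) => [|k]; last exact: adaptedZ.
  rewrite -(sum_delta (G j) j) -(sum_delta (G j) i) !mulr_sumr -big_split /=.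
  apply: eq_bigr => k _; rewrite (ExZ _ (aa j k)).
  have E := Ex_rot4 hu QQ j k i i (ayy j k).
  rewrite E /wick /G eqxx (mulr1 (j == k)%:R) (eq_sym k j).
  by ring.
by rewrite big_split /= -mulr_sumr sum_delta Gd; congr (_ + _); apply: eq_bigr => j _.
Qed.

(** Of the two copies of [lam i ^+ 2 * mom_yy t i] in [Ex_noise2], one is the square of the mean
    gradient and the other is counted as noise, in the shape that [lyap_step] expects. *)
Lemma moment_step t i :
  let b' := beta ^+ 2 * mom_mm t i + 2 * beta * lam i * mom_ym t i +
    lam i ^+ 2 * mom_yy t i +
    (lam i ^+ 2 * mom_yy t i + \sum_j lam j ^+ 2 * mom_yy t j) in
  let cc := beta * mom_ym t i + lam i * mom_yy t i in
  [/\ mom_mm t.+1 i = b', mom_ym t.+1 i = cc - eta * b' &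
      mom_yy t.+1 i = mom_yy t i - 2 * eta * cc + eta ^+ 2 * b'].
Proof.
move=> b' cc.
have mS w : m t.+1 i w = beta * m t i w + S t w * v t i w.
  by case: (rot_step t i w).
have yS w : y t.+1 i w = y t i w - eta * m t.+1 i w by case: (rot_step t i w).
have aSv : adapted P u t.+1 (fun w => S t w * v t i w) by exact: adaptedM.
have amS : adapted P u t.+1 (m t.+1 i) by exact: am.
have A1 f g (af : adapted P u t.+1 f) (ag : adapted P u t.+1 g) :
  adapted P u t.+1 (fun w => f w * g w) by exact: adaptedM.
have A2 f (af : adapted P u t.+1 f) : adapted P u t.+1 (fun w => f w ^+ 2).
  by under eq_fun do rewrite expr2; exact: adaptedM.
have bE : mom_mm t.+1 i = b'.
  rewrite /mom_mm (@eq_Rintegral _ _ _ _ _ (fun w => beta ^+ 2 * m t i w ^+ 2 +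
    (2 * beta * (m t i w * (S t w * v t i w)) + (S t w * v t i w) ^+ 2))); last first.
    by move=> w _; rewrite mS; ring.
  have a1 := adaptedZ hu (beta ^+ 2) (A2 _ (am1 t i)).
  have a2 := adaptedZ hu (2 * beta) (A1 _ _ (am1 t i) aSv).
  rewrite (ExD a1 (adaptedD hu a2 (A2 _ aSv))) (ExD a2 (A2 _ aSv)).
  rewrite (ExZ _ (A2 _ (am1 t i))) (ExZ _ (A1 _ _ (am1 t i) aSv)).
  rewrite Ex_noise1 // Ex_noise2 /b' /mom_mm.
  rewrite (_ : \int[P]_w (m t i w * y t i w) = mom_ym t i); first by ring.
  by apply: eq_Rintegral => w _; rewrite mulrC.
have ccE : \int[P]_w (y t i w * m t.+1 i w) = cc.
  rewrite (@eq_Rintegral _ _ _ _ _ (fun w => beta * (y t i w * m t i w) +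
    y t i w * (S t w * v t i w))); last by move=> w _; rewrite mS; ring.
  have a1 := A1 _ _ (ay1 t i) (am1 t i).
  rewrite (ExD (adaptedZ hu beta a1) (A1 _ _ (ay1 t i) aSv)) (ExZ _ a1).
  have yyE : \int[P]_w (y t i w * y t i w) = mom_yy t i.
    by apply: eq_Rintegral => w _; rewrite expr2.
  by rewrite Ex_noise1 // yyE.
have a1 := A1 _ _ (ay1 t i) amS.
have a2 := adaptedZ hu eta (A2 _ amS).
split=> //.
  rewrite -bE -ccE /mom_ym /mom_mm -(ExZ _ (A2 _ amS)) -(ExB a1 a2).
  by apply: eq_Rintegral => w _; rewrite yS; ring.
have a3 := adaptedZ hu (2 * eta) a1.
have a4 := adaptedZ hu (eta ^+ 2) (A2 _ amS).
rewrite -bE -ccE /mom_yy /mom_mm -(ExZ _ (A2 _ amS)) -(ExZ _ a1).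
rewrite -(ExB (A2 _ (ay1 t i)) a3) -(ExD (adaptedB hu (A2 _ (ay1 t i)) a3) a4).
by apply: eq_Rintegral => w _; rewrite yS; ring.
Qed.

Lemma mean_step t i :
  mean_m t.+1 i = beta * mean_m t i + lam i * mean_y t i /\
  mean_y t.+1 i = mean_y t i - eta * mean_m t.+1 i.
Proof.
have aSv : adapted P u t.+1 (fun w => S t w * v t i w) by exact: adaptedM.
have amS : adapted P u t.+1 (m t.+1 i) by exact: am.
split.
  rewrite /mean_m (@eq_Rintegral _ _ _ _ _ (fun w => beta * m t i w + S t w * v t i w));
    last by move=> w _; case: (rot_step t i w).
  rewrite (ExD (adaptedZ hu beta (am1 t i)) aSv) (ExZ _ (am1 t i)).
  have := Ex_noise1 i (adapted_cst P u t 1).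
  under eq_Rintegral do rewrite mul1r.
  by move=> ->; congr (_ + _ * _); apply: eq_Rintegral => w _; rewrite mul1r.
rewrite /mean_m -(ExZ _ amS) -(ExB (ay1 t i) (adaptedZ hu eta amS)).
by apply: eq_Rintegral => w _; case: (rot_step t i w).
Qed.

Lemma moment_psd t i (p q : R) :
  0 <= p ^+ 2 * mom_yy t i + 2 * (p * q) * mom_ym t i + q ^+ 2 * mom_mm t i.
Proof.
have A2 f (af : adapted P u t f) : adapted P u t (fun w => f w ^+ 2).
  by under eq_fun do rewrite expr2; exact: adaptedM.
have a1 := adaptedZ hu (p ^+ 2) (A2 _ (ay t i)).
have aym := adaptedM hu (ay t i) (am t i).
have a2 := adaptedZ hu (2 * (p * q)) aym.
have a3 := adaptedZ hu (q ^+ 2) (A2 _ (am t i)).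
rewrite -(ExZ _ (A2 _ (ay t i))) -(ExZ _ aym) -(ExZ _ (A2 _ (am t i))).
rewrite -(ExD a1 a2) -(ExD (adaptedD hu a1 a2) a3).
apply: Rintegral_ge0 => w _.
by rewrite (_ : _ + _ = (p * y t i w + q * m t i w) ^+ 2) ?sqr_ge0 //; ring.
Qed.

Lemma moment_init i :
  [/\ mom_yy 0 i = (Q^T *m (x0 - xs)) i 0 ^+ 2, mom_ym 0 i = 0 & mom_mm 0 i = 0].
Proof.
have m0 w : m 0 i w = 0 by rewrite rotE /zo_momentum /= mulmx0 mxE.
have y0 w : y 0 i w = (Q^T *m (x0 - xs)) i 0 by rewrite rotE.
rewrite /mom_yy /mom_ym /mom_mm; split.
- by under eq_Rintegral do rewrite y0; rewrite Ex_cst.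
- by under eq_Rintegral do rewrite m0 mulr0; rewrite Ex_cst.
- by under eq_Rintegral do rewrite m0 expr0n; rewrite Ex_cst.
Qed.

Lemma mean_init i : mean_y 0 i = (Q^T *m (x0 - xs)) i 0 /\ mean_m 0 i = 0.
Proof.
have m0 w : m 0 i w = 0 by rewrite rotE /zo_momentum /= mulmx0 mxE.
have y0 w : y 0 i w = (Q^T *m (x0 - xs)) i 0 by rewrite rotE.
rewrite /mean_y /mean_m; split.
  by under eq_Rintegral do rewrite y0; rewrite Ex_cst.
by under eq_Rintegral do rewrite m0; rewrite Ex_cst.
Qed.

Lemma sqnorm_rot (z : 'cV[R]_d) : sqnorm (Q^T *m z) = sqnorm z.
Proof.
have QQ' : Q *m Q^T = 1%:M by exact: mulmx1C.
have E (x : 'cV[R]_d) : sqnorm x = (x^T *m x) 0 0.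
  by rewrite mxE; apply: eq_bigr => i _; rewrite [x^T _ _]mxE expr2.
by rewrite !E trmx_mul trmxK mulmxA -(mulmxA z^T) QQ' mulmx1.
Qed.

Lemma expectation_sqnorm t :
  'E_P[fun w => sqnorm (zo_error t w)]%E = (\sum_i mom_yy t i)%:E.
Proof.
have ay2 i : adapted P u t (fun w => y t i w ^+ 2).
  by under eq_fun do rewrite expr2; exact: adaptedM.
have nE : (fun w => sqnorm (zo_error t w)) = (fun w => \sum_i y t i w ^+ 2).
  apply/funext => w; rewrite -sqnorm_rot /sqnorm.
  by apply: eq_bigr => i _; rewrite rotE.
rewrite nE /mom_yy -(Ex_sum hu _ ay2) unlock /Rintegral fineK //.
apply: integrable_fin_num => //.
exact: adapted_int (adapted_sum hu _ ay2).
Qed.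

Lemma expectation_error t i :
  'E_P[fun w => zo_error t w i ord0]%E = (\sum_j Q i j * mean_y t j)%:E.
Proof.
have QQ' : Q *m Q^T = 1%:M by exact: mulmx1C.
have zE : (fun w => zo_error t w i ord0) = (fun w => \sum_j Q i j * y t j w).
  apply/funext => w; rewrite -[zo_error t w]mul1mx -QQ' -mulmxA mxE.
  by apply: eq_bigr => j _; rewrite rotE.
have aQ j := adaptedZ hu (Q i j) (ay t j).
rewrite zE (eq_bigr (fun j => \int[P]_w (Q i j * y t j w))) => [|j _]; last first.
  by rewrite (ExZ _ (ay t j)).
rewrite -(Ex_sum hu _ aQ) unlock /Rintegral fineK //.
by apply: integrable_fin_num => //; exact: adapted_int (adapted_sum hu _ aQ).
Qed.

Lemma sqnorm_mean t :
  \sum_i (\sum_j Q i j * mean_y t j) ^+ 2 = \sum_j mean_y t j ^+ 2.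
Proof.
pose z : 'cV[R]_d := \col_i \sum_j Q i j * mean_y t j.
have -> : \sum_i (\sum_j Q i j * mean_y t j) ^+ 2 = sqnorm z.
  by apply: eq_bigr => i _; rewrite mxE.
have zE : z = Q *m (\col_j mean_y t j).
  by apply/colP => i; rewrite !mxE; apply: eq_bigr => j _; rewrite mxE.
rewrite -sqnorm_rot zE mulmxA QQ mul1mx.
by apply: eq_bigr => i _; rewrite mxE.
Qed.

End Dynamics.

(** * Stability thresholds *)

Section MomentSystem.
Variables (R : realType) (d : nat) (lam : 'I_d -> R) (beta eta : R).
Hypotheses (lam_ge0 : forall i, 0 <= lam i).
Hypotheses (b0 : 0 <= beta) (b1 : beta < 1) (e0 : 0 < eta).
Variables a c b : nat -> 'I_d -> R.

Let s t := \sum_j lam j ^+ 2 * a t j.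

Hypothesis step : forall t i,
  let b' := beta ^+ 2 * b t i + 2 * beta * lam i * c t i +
    lam i ^+ 2 * a t i + (lam i ^+ 2 * a t i + s t) in
  let cc := beta * c t i + lam i * a t i in
  [/\ b t.+1 i = b', c t.+1 i = cc - eta * b' &
      a t.+1 i = a t i - 2 * eta * cc + eta ^+ 2 * b'].
Hypothesis psd : forall t i (p q : R),
  0 <= p ^+ 2 * a t i + 2 * (p * q) * c t i + q ^+ 2 * b t i.
Hypotheses (c0 : forall i, c 0 i = 0) (bb0 : forall i, b 0 i = 0).

Let q t i := lyap beta eta (lam i) (a t i) (c t i) (b t i).
Let tau i := lyap_tau beta eta (lam i).

Let a_ge0 t i : 0 <= a t i.
Proof. by have := psd t i 1 0; rewrite expr1n expr0n mul1r !(mulr0, mul0r) !addr0. Qed.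

Let b_ge0 t i : 0 <= b t i.
Proof. by have := psd t i 0 1; rewrite expr1n expr0n mul1r !(mulr0, mul0r) !add0r. Qed.

Let s_ge0 t : 0 <= s t.
Proof. by apply: sumr_ge0 => i _; rewrite mulr_ge0 ?sqr_ge0. Qed.

Let le_s t i : lam i ^+ 2 * a t i <= s t.
Proof.
rewrite /s (bigD1 i) //= lerDl sumr_ge0 // => j _.
by rewrite mulr_ge0 ?sqr_ge0.
Qed.

Let q_step t i : q t.+1 i = q t i + (lam i * (lam i - tau i) * a t i + s t).
Proof.
have [bE cE aE] := step t i; rewrite /q bE cE aE lyap_step //.
by rewrite /tau; ring.
Qed.

Lemma ms_term_tau i : eta * lambda_max lam < 1 - beta ^+ 2 ->
  ms_term lam beta eta i * (tau i - lam i) = lam i.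
Proof.
move=> el; have h := ms_den_gt0 b0 b1 i (ltW e0) el.
have c1 : 0 < 1 - beta ^+ 2 by rewrite subr_gt0 expr_lt1.
have c2 : 0 < 1 - beta ^+ 2 - eta * lam i.
  rewrite subr_gt0; apply: le_lt_trans el.
  by rewrite ler_wpM2l ?(ltW e0) // le_lambda_max.
rewrite /ms_term /tau /lyap_tau; move: (b0) (b1) (e0) => ? ? ?; field.
by rewrite !gt_eqF //; lra.
Qed.

Let V (wt : 'I_d -> R) t := \sum_i wt i * q t i.

Let V_step t : eta * lambda_max lam < 1 - beta ^+ 2 ->
  V (ms_term lam beta eta) t.+1 =
  V (ms_term lam beta eta) t + (\sum_i ms_term lam beta eta i - 1) * s t.
Proof.
move=> el; rewrite /V mulrBl mul1r mulr_suml {2}/s -sumrB -big_split /=.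
apply: eq_bigr => i _; rewrite q_step.
have := ms_term_tau i el; set w := ms_term _ _ _ _ => wE.
rewrite [lam i ^+ 2](_ : _ = lam i * (w * (tau i - lam i))); first by ring.
by rewrite wE expr2.
Qed.

Lemma moments_bounded : eta * lambda_max lam < 1 - beta ^+ 2 ->
  \sum_i ms_term lam beta eta i < 1 ->
  exists M, forall t, \sum_i a t i <= M.
Proof.
move=> el g1; set w := ms_term lam beta eta in g1 *.
(* [S] bounds all partial sums of [s], by telescoping and [V >= 0]. *)
pose g := \sum_i w i; pose S := V w 0 / (1 - g).
have g0 : 0 < 1 - g by rewrite subr_gt0.
have eli i : eta * lam i <= 2 * (1 + beta).
  apply: le_trans (_ : eta * lambda_max lam <= _).
    by rewrite ler_wpM2l ?(ltW e0) // le_lambda_max.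
  apply/ltW/(lt_trans el); have := sqr_ge0 beta; move: (b0) => ?; lra.
have q_ge0 t i : 0 <= q t i by apply: lyap_ge0 => //; exact: psd.
have V_ge0 t : 0 <= V w t.
  apply: sumr_ge0 => i _; rewrite mulr_ge0 //.
  by apply: ms_term_ge0 => //; exact: ltW.
have Vsum t : V w t + (1 - g) * \sum_(k < t) s k = V w 0.
  elim: t => [|t IH]; first by rewrite big_ord0 mulr0 addr0.
  by rewrite big_ord_recr /= -IH V_step // -/w -/g; ring.
have sumS t : \sum_(k < t) s k <= S.
  rewrite /S ler_pdivlMr // mulrC -(Vsum t) lerDr; exact: V_ge0.
have sS t : s t <= S.
  apply: le_trans (sumS t.+1); rewrite big_ord_recr /= lerDr.
  by apply: sumr_ge0 => k _; exact: s_ge0.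
(* For a null eigenvalue the form is [E (r y - beta m)^2]; it only collects noise, so it exceeds its
   initial value by a partial sum of [s], which also bounds [b]. *)
pose r := (1 - beta) / eta.
have r0 : 0 < r by rewrite divr_gt0 // subr_gt0.
exists (\sum_i if lam i == 0 then (2 * (q 0 i + S) + 2 * beta ^+ 2 * S) / r ^+ 2
        else S / lam i ^+ 2) => t.
apply: ler_sum => i _; case: eqP => [l0|/eqP l0]; last first.
  have l2 : 0 < lam i ^+ 2 by rewrite exprn_even_gt0.
  by rewrite ler_pdivlMr // mulrC; exact: le_trans (le_s t i) (sS t).
have qE k : q k i = q 0 i + \sum_(j < k) s j.
  elim: k => [|k IH]; first by rewrite big_ord0 addr0.
  by rewrite q_step IH l0 !mul0r add0r big_ord_recr /= addrA.
have bS k : b k i <= \sum_(j < k) s j.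
  elim: k => [|k IH]; first by rewrite big_ord0 bb0.
  have [-> _ _] := step k i; rewrite big_ord_recr /= l0.
  rewrite (_ : _ + _ = beta ^+ 2 * b k i + s k); last by ring.
  rewrite lerD2r; apply: le_trans IH.
  by rewrite ler_piMl // expr_le1 // ltW.
have qlE : q t i = r ^+ 2 * a t i - 2 * (r * beta) * c t i + beta ^+ 2 * b t i.
  rewrite /q /lyap /lyap_p /lyap_rho /lyap_tau l0 /r.
  by move: (b0) (e0) => ? ?; field; rewrite !gt_eqF //; lra.
(* [E (r y - 2 beta m)^2 >= 0] says exactly [r^2 a <= 2 q + 2 beta^2 b]. *)
have p1 := psd t i r (- 2 * beta).
have h1 := qE t; have h2 := sumS t; have h3 := bS t.
have h4 : beta ^+ 2 * b t i <= beta ^+ 2 * S.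
  by rewrite ler_wpM2l ?sqr_ge0 // (le_trans h3).
rewrite ler_pdivlMr ?exprn_gt0 //.
rewrite qlE in h1.
move: p1 h1 h2 h4; rewrite exprMn; move: (\sum_(_ < _) _) (q 0 i) => x1 x2; lra.
Qed.

(** The weights must vanish on null eigenvalues: there [s] gives no control of [a], and [V] could
    not be bounded by [s]. *)
Lemma moments_unbounded (wt : 'I_d -> R) (k : 'I_d) (eps M : R) :
  (forall i, 0 <= wt i) -> (forall i, lam i = 0 -> wt i = 0) ->
  0 < wt k -> 0 < a 0 k -> 0 < eps ->
  (forall t, V wt t + eps * s t <= V wt t.+1) ->
  exists t, M < \sum_i a t i.
Proof.
move=> w0 wl wk ak eps0 Vs.
pose C i := lyap_p beta eta (lam i) + 3 * `|lyap_rho beta eta (lam i) * beta| / eta +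
    2 * beta ^+ 2 / eta ^+ 2.
have C0 i : 0 <= C i.
  have p0 := ltW (lyap_p_gt0 b0 b1 e0 (lam_ge0 i)).
  have n0 := normr_ge0 (lyap_rho beta eta (lam i) * beta).
  apply: addr_ge0; first by apply: addr_ge0 => //; rewrite divr_ge0 ?mulr_ge0 ?(ltW e0).
  by apply: divr_ge0; [apply: mulr_ge0 => //|]; exact: sqr_ge0.
pose K := \sum_i wt i * C i / lam i ^+ 2.
have K0 : 0 <= K.
  by apply: sumr_ge0 => i _; apply: divr_ge0; [exact: mulr_ge0|exact: sqr_ge0].
have V0 : 0 < V wt 0.
  have q0 i : 0 <= wt i * q 0 i.
    rewrite mulr_ge0 // /q /lyap c0 bb0 !mulr0 !addr0 mulr_ge0 //.
    exact/ltW/lyap_p_gt0.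
  rewrite /V (bigD1 k) //= ltr_pwDl ?sumr_ge0 //.
  by rewrite mulr_gt0 // /q /lyap c0 bb0 !mulr0 !addr0 mulr_gt0 // lyap_p_gt0.
have VK t : V wt t.+1 <= K * (s t + s t.+1).
  rewrite /V /K mulr_suml; apply: ler_sum => i _.
  have [l0|l0] := eqVneq (lam i) 0; first by rewrite wl // !mul0r.
  have [bE cE aE] := step t i.
  have qC : q t.+1 i <= C i * (a t i + a t.+1 i).
    apply: lyap_le => //.
      rewrite (_ : _ + _ = 2 ^+ 2 * a t.+1 i + 2 * (2 * eta) * c t.+1 i +
        eta ^+ 2 * b t.+1 i); last by ring.
      exact: psd.
    by rewrite aE cE bE; ring.
  apply: le_trans (_ : wt i * (C i * (a t i + a t.+1 i)) <= _).
    by rewrite ler_wpM2l.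
  rewrite [leRHS](_ : _ = wt i * (C i * ((s t + s t.+1) / lam i ^+ 2))); last by ring.
  rewrite !ler_wpM2l // ler_pdivlMr ?exprn_even_gt0 // mulrDl.
  by rewrite lerD // mulrC le_s.
(* The level is rescaled because [s] is at most [lambda_max lam ^+ 2] times the sum of the
   [a t i]. *)
have [t Mt] := unbounded_growth (lambda_max lam ^+ 2 * M) eps0 K0 V0 s_ge0 Vs VK.
exists t; apply: contraTT Mt; rewrite -!leNgt => aM.
apply: le_trans (_ : lambda_max lam ^+ 2 * \sum_i a t i <= _).
  rewrite /s mulr_sumr; apply: ler_sum => i _; rewrite ler_wpM2r //.
  by rewrite lerXn2r ?nnegrE ?le_lambda_max // (le_trans (lam_ge0 i)) // le_lambda_max.
by rewrite ler_wpM2l ?sqr_ge0.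
Qed.

Lemma moments_unbounded_above (k : 'I_d) (M : R) :
  lambda_max lam = lam k -> 0 < lam k -> 0 < a 0 k ->
  1 - beta ^+ 2 <= eta * lam k \/ 1 < \sum_i ms_term lam beta eta i ->
  exists t, M < \sum_i a t i.
Proof.
move=> kmax lk ak.
have [el|el] := leP (1 - beta ^+ 2) (eta * lam k).
  (* The [k]-th critical term is no longer a positive weight, its denominator being zero or
     negative. But [tau k <= lam k], so the form of [k] alone gains at least [s]. *)
  move=> _; apply: (@moments_unbounded (fun i => (i == k)%:R) k 1) => //.
  - by move=> i li; case: eqP => // ik; move: lk; rewrite -ik li ltxx.
  - by rewrite eqxx.
  - have VE t : V (fun i => (i == k)%:R) t = q t k.
      rewrite /V (bigD1 k) //= eqxx mul1r big1 ?addr0 // => i /negbTE ->.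
      by rewrite mul0r.
    move=> t; rewrite !VE q_step mul1r lerD2l lerDr mulr_ge0 // mulr_ge0 // subr_ge0.
    have := lyap_tau_sub (lam k) b0 e0.
    rewrite -/(tau k) => tE; rewrite -subr_le0.
    have b10 : 0 < 1 + beta by move: (b0) => ?; lra.
    rewrite -(pmulr_rle0 _ e0) -(pmulr_lle0 _ b10) tE; move: el; lra.
move=> [//|g1].
have el' : eta * lambda_max lam < 1 - beta ^+ 2 by rewrite kmax.
apply: (@moments_unbounded (ms_term lam beta eta) k
  (\sum_i ms_term lam beta eta i - 1)) => //.
- by move=> i; apply: ms_term_ge0 => //; exact: ltW.
- by move=> i li; rewrite /ms_term li !mulr0 mul0r.
- rewrite /ms_term; have h := ms_den_gt0 b0 b1 k (ltW e0) el'.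
  have q0 : 0 < 2 * (1 - beta) by move: (b1) => ?; lra.
  exact: divr_gt0 (mulr_gt0 e0 lk) (mulr_gt0 q0 h).
- by rewrite subr_gt0.
- by move=> t; rewrite V_step.
Qed.

End MomentSystem.

(** * First moments along one eigendirection *)

Section MeanSystem.
Variables (R : realType) (beta eta l : R) (y m : nat -> R).
Hypotheses (l0 : 0 <= l) (b0 : 0 <= beta) (b1 : beta < 1) (e0 : 0 < eta).
Hypothesis step : forall t, m t.+1 = beta * m t + l * y t /\
  y t.+1 = y t - eta * m t.+1.
Hypothesis m0 : m 0 = 0.

Let q t := lyap beta eta l (y t ^+ 2) (y t * m t) (m t ^+ 2).
Let tau := lyap_tau beta eta l.

Let q_step t : q t.+1 = q t - l * tau * y t ^+ 2.
Proof.
have [mE yE] := step t.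
have := lyap_step l (y t ^+ 2) (y t * m t) (m t ^+ 2) 0 b0 e0.
rewrite /= !addr0 -/tau => <-; rewrite /q yE mE; congr lyap; ring.
Qed.

Let tauE : eta * (1 + beta) * tau = (1 - beta) * (2 * (1 + beta) - eta * l).
Proof.
rewrite /tau /lyap_tau; move: (b0) (e0) => ? ?; field.
by rewrite !gt_eqF //; lra.
Qed.

Let eb0 : 0 < eta * (1 + beta).
Proof. by rewrite mulr_gt0 //; move: (b0) => ?; lra. Qed.

Lemma mean_bounded_below : eta * l < 2 * (1 + beta) ->
  exists M, forall t, y t ^+ 2 <= M.
Proof.
move=> el; have := l0; rewrite le_eqVlt => /predU1P[l00|lp].
  (* Without curvature the form dissipates nothing; instead the momentum stays zero and [y] is
     constant. *)
  have mz t : m t = 0.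
    by elim: t => // t IH; have [-> _] := step t; rewrite IH -l00 mulr0 mul0r addr0.
  exists (y 0 ^+ 2) => t; rewrite (_ : y t = y 0) //.
  elim: t => // t <-; have [_ ->] := step t.
  by rewrite mz mulr0 subr0.
have tp : 0 < tau.
  by rewrite -(pmulr_rgt0 _ eb0) tauE mulr_gt0 // subr_gt0.
have lt0 : 0 < l * tau by rewrite mulr_gt0.
have q_ge0 t : 0 <= q t.
  apply: lyap_ge0 => //; [exact: sqr_ge0| |exact: ltW] => p r.
  by rewrite (_ : _ + _ = (p * y t + r * m t) ^+ 2) ?sqr_ge0 //; ring.
have q_le t : q t <= q 0.
  elim: t => // t; apply: le_trans; rewrite q_step gerBl.
  by rewrite mulr_ge0 ?sqr_ge0 // ltW.
exists (q 0 / (l * tau)) => t; rewrite ler_pdivlMr // mulrC.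
(* The next value of the form is [q t - l * tau * y t ^+ 2], and it is nonnegative. *)
apply: le_trans (q_le t); rewrite -subr_ge0 -q_step; exact: q_ge0.
Qed.

Lemma mean_unbounded_above (M : R) : 2 * (1 + beta) < eta * l -> y 0 != 0 ->
  exists t, M < y t ^+ 2.
Proof.
move=> el y0.
have lp : 0 < l.
  rewrite -(pmulr_rgt0 _ e0); apply: lt_trans el; move: (b0) => ?; lra.
have tn : tau < 0.
  by rewrite -(pmulr_rlt0 _ eb0) tauE pmulr_rlt0 ?subr_gt0 // subr_lt0.
pose C := lyap_p beta eta l + 3 * `|lyap_rho beta eta l * beta| / eta +
    2 * beta ^+ 2 / eta ^+ 2.
have C0 : 0 <= C.
  have p0 := ltW (lyap_p_gt0 b0 b1 e0 l0).
  have n0 := normr_ge0 (lyap_rho beta eta l * beta).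
  apply: addr_ge0; first by apply: addr_ge0 => //; rewrite divr_ge0 ?mulr_ge0 ?(ltW e0).
  by apply: divr_ge0; [apply: mulr_ge0 => //|]; exact: sqr_ge0.
apply: (@unbounded_growth _ q (fun t => y t ^+ 2) (- (l * tau)) C) => //.
- by rewrite oppr_gt0 pmulr_rlt0.
- rewrite /q m0 /lyap expr0n !mulr0 !addr0 mulr_gt0 ?lyap_p_gt0 //.
  by rewrite exprn_even_gt0.
- by move=> t; exact: sqr_ge0.
- by move=> t; rewrite q_step mulNr.
- move=> t; have [mE yE] := step t; apply: lyap_le => //; try exact: sqr_ge0.
    by rewrite (_ : _ + _ = (2 * y t.+1 + eta * m t.+1) ^+ 2) ?sqr_ge0 //; ring.
  by rewrite yE; ring.
Qed.

End MeanSystem.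

Lemma sup_eq_threshold (R : realType) (A : set R) (x : R) : 0 < x ->
  (forall z, 0 < z -> z < x -> A z) -> (forall z, A z -> z <= x) -> sup A = x.
Proof.
move=> x0 lo up.
(* Makes [A] nonempty; otherwise [sup] would be a default value. *)
have A2 : A (x / 2) by apply: lo; lra.
have hs : has_sup A by split; [exists (x / 2) | exists x].
apply/le_anti/andP; split; first by apply: ge_sup => //; exists (x / 2).
rewrite leNgt; apply/negP => sx.
have s0 : x / 2 <= sup A by exact: sup_upper_bound.
have : A ((sup A + x) / 2) by apply: lo; lra.
by move=> /(sup_upper_bound hs); lra.
Qed.

(** * Critical step sizes of the iteration *)

Section Thresholds.
Context {R : realType} {dT : measure_display} {T : measurableType dT}.
Variables (P : probability T R) (d : nat) (u : nat -> T -> 'cV[R]_d).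
Hypothesis hu : iid_std_gaussian P u.
Variables (H Q : 'M[R]_d) (lam : 'I_d -> R).
Hypothesis Ht : H^T = H.
Hypothesis QQ : Q^T *m Q = 1%:M.
Hypothesis QH : Q^T *m H *m Q = diag_mx (\row_i lam i).
Hypotheses (lam_ge0 : forall i, 0 <= lam i) (lam_n0 : exists i, lam i != 0).
Variables (c beta mu : R) (xs : 'cV[R]_d).
Hypotheses (b0 : 0 <= beta) (b1 : beta < 1) (mu0 : mu != 0).

Local Notation F := (fquad c xs H).

(** The initial error is the [k]-th eigenvector; with [k] a largest eigenvalue it excites the
    direction that becomes unstable. *)
Let x0_of (k : 'I_d) : 'cV[R]_d := xs + Q *m delta_mx k 0.

Let x0_ofE k : (Q^T *m (x0_of k - xs)) k 0 = 1.
Proof. by rewrite /x0_of addrAC subrr add0r mulmxA QQ mul1mx mxE !eqxx. Qed.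

Lemma eta_ms_eq eta : ms_condition lam beta eta ->
  eta_ms P F mu beta xs u = eta.
Proof.
move=> [e0 [el eE]].
have [lmax0 [k kmax]] := lambda_max_attained lam_ge0 lam_n0.
apply: sup_eq_threshold => // z.
  move=> z0 ze; split=> // x0.
  have zl : z * lambda_max lam < 1 - beta ^+ 2.
    by apply: lt_trans el; rewrite ltr_pM2r.
  have g1 : \sum_i ms_term lam beta z i < 1.
    by rewrite -[ltRHS]eE; apply: ms_sum_lt => //; exact: ltW.
  have [M hM] := moments_bounded lam_ge0 b0 b1 z0
    (moment_step hu Ht QQ QH c beta z xs x0 mu0)
    (moment_psd hu Ht QQ QH c beta z xs x0 mu0)
    (fun i => let: And3 _ _ h := moment_init P u H Q c beta mu z xs x0 i in h) zl g1.
  exists M => t; rewrite (expectation_sqnorm hu Ht QQ QH c beta z xs x0 mu0).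
  by rewrite lee_fin.
move=> [z0 zb]; rewrite leNgt; apply/negP => ez.
have [M hM] := zb (x0_of k).
have [|||||t] := @moments_unbounded_above R d lam beta z lam_ge0 b0 b1 z0 _ _ _
    (moment_step hu Ht QQ QH c beta z xs (x0_of k) mu0)
    (moment_psd hu Ht QQ QH c beta z xs (x0_of k) mu0) _ _ k M kmax.
- by move=> i; case: (moment_init P u H Q c beta mu z xs (x0_of k) i).
- by move=> i; case: (moment_init P u H Q c beta mu z xs (x0_of k) i).
- by rewrite -kmax.
- by case: (moment_init P u H Q c beta mu z xs (x0_of k) k) => -> _ _; rewrite x0_ofE expr1n.
(* Beyond the root either the constraint fails or, by strict monotonicity, the sum exceeds 1. *)
- case: (leP (1 - beta ^+ 2) (z * lam k)) => h; [by left | right].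
  rewrite -[ltLHS]eE; apply: ms_sum_lt => //; first exact: ltW.
  by rewrite kmax.
rewrite ltNge; apply/negP; rewrite negbK -lee_fin.
by rewrite -(expectation_sqnorm hu Ht QQ QH c beta z xs (x0_of k) mu0); exact: hM.
Qed.

Lemma eta_mean_eq : eta_mean P F mu beta xs u = 2 * (1 + beta) / lambda_max lam.
Proof.
have [lmax0 [k kmax]] := lambda_max_attained lam_ge0 lam_n0.
have q0 : 0 < 2 * (1 + beta) by move: (b0) => ?; lra.
apply: sup_eq_threshold; first exact: divr_gt0.
  move=> z z0; rewrite ltr_pdivlMr // => zl; split=> // x0.
  have hM i : exists M, forall t, mean_y P u H Q c beta mu z xs x0 t i ^+ 2 <= M.
    apply: (mean_bounded_below (lam_ge0 i) b0 b1 z0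
      (fun t => mean_step hu Ht QQ QH c beta z xs x0 mu0 t i)).
      by case: (mean_init P u H Q c beta mu z xs x0 i).
    by apply: le_lt_trans zl; rewrite ler_wpM2l ?(ltW z0) // le_lambda_max.
  have [M {}hM] := choice hM.
  exists (Num.sqrt (\sum_i M i)) => t.
  have EE i := expectation_error hu Ht QQ QH c beta z xs x0 mu0 t i.
  rewrite /zo_error in EE; split=> [i|]; first by rewrite EE.
  under eq_bigr do rewrite EE /=.
  rewrite (sqnorm_mean P u H QQ c beta mu z xs x0 t).
  by rewrite ler_wsqrtr // ler_sum.
move=> z [z0 zb]; rewrite ler_pdivlMr // leNgt; apply/negP => zl.
have [M hM] := zb (x0_of k).
have [|||t] := @mean_unbounded_above R beta z (lam k) _ _ (lam_ge0 k) b0 b1 z0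
  (fun t => mean_step hu Ht QQ QH c beta z xs (x0_of k) mu0 t k) _ (M ^+ 2).
- by case: (mean_init P u H Q c beta mu z xs (x0_of k) k).
- by rewrite -kmax.
- case: (mean_init P u H Q c beta mu z xs (x0_of k) k) => -> _.
  by rewrite x0_ofE oner_eq0.
have [_] := hM t.
have EE i := expectation_error hu Ht QQ QH c beta z xs (x0_of k) mu0 t i.
rewrite /zo_error in EE; under eq_bigr do rewrite EE /=.
rewrite (sqnorm_mean P u H QQ c beta mu z xs (x0_of k) t) => sM.
rewrite ltNge => /negP; apply; set s := \sum_j _ in sM.
have s0 : 0 <= s by apply: sumr_ge0 => j _; exact: sqr_ge0.
apply: le_trans (_ : s <= _).
  by rewrite /s (bigD1 k) //= lerDl sumr_ge0 // => j _; exact: sqr_ge0.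
rewrite -(sqr_sqrtr s0); apply: lerXn2r; rewrite ?nnegrE ?sqrtr_ge0 //.
exact: le_trans (sqrtr_ge0 _) sM.
Qed.

End Thresholds.

Theorem theorem4p9 (R : realType) (d : nat) (f : 'cV[R]_d -> R)
  (xstar : 'cV[R]_d) (lam : 'I_d -> R) (beta mu : R)
  (dT : measure_display) (T : measurableType dT) (P : probability T R)
  (u : nat -> T -> 'cV[R]_d) :
  local_minimizer f xstar ->
  twice_differentiable_near f xstar ->
  psd (hessian f xstar) ->
  hessian f xstar != 0 ->
  eigenvalues_of (hessian f xstar) lam ->
  (forall i j : 'I_d, (i <= j)%N -> lam j <= lam i) ->
  (forall i, 0 <= lam i) ->
  0 <= beta -> beta < 1 -> 0 < mu ->
  iid_std_gaussian P u ->
  let H := hessian f xstar in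
  let F := fquad (f xstar) xstar H in
  let emean := eta_mean P F mu beta xstar u in
  let ems := eta_ms P F mu beta xstar u in
  emean = 2 * (1 + beta) / lambda_max lam /\
  ms_condition lam beta ems /\
  (forall eta, ms_condition lam beta eta -> eta = ems) /\
  2 * (1 - beta) / (\tr H + 2 * lambda_max lam / (1 + beta)) <= ems /\
  ems <= 2 * (1 - beta) / \tr H.
Proof.
move=> _ _ [Ht _] H0 Hl _ lam_ge0 b0 b1 mu_gt0 hu H F emean ems.
have mu0 : mu != 0 by rewrite gt_eqF.
have [Q [QQ QH]] := symmetric_diagonalization Ht Hl.
rewrite -/H in Ht QH H0.
have QQ' : Q *m Q^T = 1%:M by exact: mulmx1C.
have lam_n0 : exists i, lam i != 0.
  apply: contrapT => /forallNP lam0; move/negP: H0; apply; apply/eqP.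
  have -> : H = Q *m diag_mx (\row_i lam i) *m Q^T.
    by rewrite -QH !mulmxA QQ' mul1mx -mulmxA QQ' mulmx1.
  have -> : \row_i lam i = 0.
    by apply/rowP => i; rewrite !mxE; apply/eqP/negPn/negP/lam0.
  by rewrite linear0 mulmx0 mul0mx.
have trE : \tr H = \sum_i lam i.
  rewrite -[H]mulmx1 -QQ' mulmxA mxtrace_mulC mulmxA QH mxtrace_diag.
  by apply: eq_bigr => i _; rewrite mxE.
have [eta eta_cond] := ms_condition_exists lam_ge0 b0 b1 lam_n0.
have emsE : ems = eta by exact: (eta_ms_eq hu Ht QQ QH).
split; first exact: (eta_mean_eq hu Ht QQ QH).
rewrite emsE trE; split=> //; split=> [eta' h|].
  exact: (ms_condition_uniq lam_ge0 b0 b1 lam_n0).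
by split; [exact: ms_condition_lower|exact: ms_condition_upper].
Qed.
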